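(* There exists an algorithm which, given a semi-complete digraph $T$ and integers $k$ and $\ell\ge 5k$, in time $O(k|V(T)|^2)$ outputs one of the following: (1) an $(\ell+2,k)$-degree tangle in $T$; (2) a $(k+1,k)$-matching tangle in $T$; (3) a path decomposition of $T$ of width at most $\ell+2k$. In the first two cases $\mathbf{pw}(T)>k$.
   Context: All digraphs are simple. A digraph $T$ is semi-complete if for every two distinct vertices $v,w$ at least one of the arcs $(v,w)$, $(w,v)$ is present. $d^+(v)$ is the outdegree of $v$. A path decomposition of a digraph $G=(V,E)$ is a sequence $(W_1,\dots,W_r)$ of subsets of $V$ such that (i) $\bigcup_i W_i=V$; (ii) $W_i\cap W_k\subseteq W_j$ for $1\le i<j<k\le r$; (iii) for every arc $(u,v)\in E$, either $u,v\in W_i$ for some $i$, or $u\in W_i$, $v\in W_j$ for some $i>j$. Its width is $\max_i(|W_i|-1)$, and $\mathbf{pw}(G)$ is the minimum width of a path decomposition of $G$. For integers $k,\ell$: a $(k,\ell)$-degree tangle is a set $X\subseteq V(T)$ with $|X|\ge k$ and $|d^+(v)-d^+(w)|\le\ell$ for all $v,w\in X$; a $(k,\ell)$-matching tangle is a pair of disjoint sets $X,Y\subseteq V(T)$ with $|X|=|Y|=k$, such that there is a bijection $f:X\to Y$ with $(v,f(v))\in E(T)$ for all $v\in X$, and $d^+(w)>d^+(v)+\ell$ for all $v\in X$, $w\in Y$. *)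

(* Defs.v *)
From mathcomp Require Import all_boot all_order all_algebra.
From mathcomp Require Import boolp.

Set Implicit Arguments.
Unset Strict Implicit.
Unset Printing Implicit Defensive.

(* A digraph on a finite vertex set V is given by its arc
   relation, so parallel arcs are impossible; opposite arcs are allowed. *)

Section Digraphs.
Variable V : finType.
Implicit Types (T : rel V) (X Y : {set V}) (Ws : seq {set V}).

Definition simple T := irreflexive T.

Definition semi_complete T := forall v w, v != w -> T v w || T w v.

Definition outdegree T (v : V) : nat := #|[set w | T v w]|.

(* `|m - n|%N is the absolute value of the signed difference. *)
Definition degree_tangle T (k l : nat) X : Prop :=
  k <= #|X| /\
  {in X &, forall v w, `|outdegree T v - outdegree T w|%N <= l}.

Definition matching_tangle T (k l : nat) X Y : Prop :=
  [/\ [disjoint X & Y],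
      #|X| = k,
      #|Y| = k,
      exists f : V -> V,
        [/\ {in X &, injective f}, f @: X = Y & {in X, forall v, T v (f v)}]
    & {in X & Y, forall v w, outdegree T v + l < outdegree T w}].

Local Notation bag Ws i := (nth set0 Ws i).

Definition path_decomposition T Ws : Prop :=
  [/\ \bigcup_(W <- Ws) W = [set: V],
      forall i j k, i < j -> j < k -> k < size Ws ->
        bag Ws i :&: bag Ws k \subset bag Ws j
    & forall u v, T u v ->
        (exists i, [/\ i < size Ws, u \in bag Ws i & v \in bag Ws i]) \/
        (exists i j, [/\ j < i, i < size Ws, u \in bag Ws i & v \in bag Ws j])].

(* An empty bag contributes 0 instead of -1; this is immaterial as soon as V
   is nonempty, since then some bag is nonempty. *)
Definition width Ws : nat := \max_(W <- Ws) #|W|.-1.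

Lemma ex_width T :
  exists w, `[< exists2 Ws, path_decomposition T Ws & width Ws = w >].
Proof.
exists (width [:: [set: V]]); apply/asboolP; exists [:: [set: V]] => //.
split; first by rewrite big_seq1.
  by move=> i [|j] [|k].
by move=> u v _; left; exists 0; rewrite !inE.
Qed.

Definition pathwidth T : nat := ex_minn (ex_width T).

End Digraphs.

(* Unit-cost random-access machine, presented as while-programs over arrays of
   natural numbers with a write-only output tape.  Arrays are unbounded and
   are named by numerals of the program text, so that a program only uses
   finitely many of them; the index into an array is computed, which gives
   indirect addressing.  The only arithmetic operations are addition and
   truncated subtraction. *)

Inductive expr : Type :=
| Num of nat
| Read of nat & expr
| Add of expr & expr
| Sub of expr & expr.

Inductive cmd : Type :=
| Skip
| Write of nat & expr & expr  (* Write a i e : a[i] := e *)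
| Emit of expr
| Seq of cmd & cmd
| If of expr & cmd & cmd
| While of expr & cmd.

Record state : Type := State { mem : nat -> nat -> nat; tape : seq nat }.

Fixpoint eval (m : nat -> nat -> nat) (e : expr) : nat :=
  match e with
  | Num c => c
  | Read a i => m a (eval m i)
  | Add e1 e2 => eval m e1 + eval m e2
  | Sub e1 e2 => eval m e1 - eval m e2
  end.

Fixpoint ecost (e : expr) : nat :=
  match e with
  | Num _ => 1
  | Read _ i => (ecost i).+1
  | Add e1 e2 | Sub e1 e2 => (ecost e1 + ecost e2).+1
  end.

Definition upd (m : nat -> nat -> nat) (a i x : nat) : nat -> nat -> nat :=
  fun b j => if (b == a) && (j == i) then x else m b j.

(* exec c s s' t : started in s, the program c halts in s' after t steps.
   Tests succeed on nonzero values. *)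
Inductive exec : cmd -> state -> state -> nat -> Prop :=
| exec_Skip s : exec Skip s s 1
| exec_Write a i e s :
    exec (Write a i e) s
      (State (upd (mem s) a (eval (mem s) i) (eval (mem s) e)) (tape s))
      (ecost i + ecost e).+1
| exec_Emit e s :
    exec (Emit e) s (State (mem s) (rcons (tape s) (eval (mem s) e)))
      (ecost e).+1
| exec_Seq c1 c2 s1 s2 s3 t1 t2 :
    exec c1 s1 s2 t1 -> exec c2 s2 s3 t2 -> exec (Seq c1 c2) s1 s3 (t1 + t2)
| exec_IfT e c1 c2 s s' t :
    eval (mem s) e != 0 -> exec c1 s s' t ->
    exec (If e c1 c2) s s' (ecost e + t).+1
| exec_IfF e c1 c2 s s' t :
    eval (mem s) e = 0 -> exec c2 s s' t ->
    exec (If e c1 c2) s s' (ecost e + t).+1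
| exec_WhileT e c s1 s2 s3 t1 t2 :
    eval (mem s1) e != 0 -> exec c s1 s2 t1 -> exec (While e c) s2 s3 t2 ->
    exec (While e c) s1 s3 (ecost e + t1 + t2).+1
| exec_WhileF e c s :
    eval (mem s) e = 0 -> exec (While e c) s s (ecost e).+1.

(* Array 0 holds n, k, l; array 1 holds the adjacency matrix of T in row-major
   order; every other cell is 0. *)
Definition input (n : nat) (T : rel 'I_n) (k l : nat) : state :=
  State (fun a i =>
           match a with
           | 0 => nth 0 [:: n; k; l] i
           | 1 => [exists u : 'I_n, exists v : 'I_n, (i == u * n + v) && T u v]
           | _ => 0
           end)
        [::].

Inductive outcome (n : nat) : Type :=
| DegreeTangle of {set 'I_n}
| MatchingTangle of {set 'I_n} & {set 'I_n}
| PathDecomposition of seq {set 'I_n}.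

Definition tag n (o : outcome n) : nat :=
  match o with
  | DegreeTangle _ => 1
  | MatchingTangle _ _ => 2
  | PathDecomposition _ => 3
  end.

Definition sets n (o : outcome n) : seq {set 'I_n} :=
  match o with
  | DegreeTangle X => [:: X]
  | MatchingTangle X Y => [:: X; Y]
  | PathDecomposition Ws => Ws
  end.

Definition lists n (s : seq nat) (X : {set 'I_n}) : bool :=
  perm_eq s [seq val x | x in X].

(* The tape holds the tag and then, for each set in turn, its cardinality
   followed by its elements, each once and in any order. *)
Definition output n (w : seq nat) (o : outcome n) : Prop :=
  exists2 ss : seq (seq nat),
    all2 (@lists n) ss (sets o) &
    w = tag o :: flatten [seq size s :: s | s <- ss].

Definition correct n (T : rel 'I_n) (k l : nat) (o : outcome n) : Prop :=
  match o with
  | DegreeTangle X => degree_tangle T (l + 2) k X /\ k < pathwidth T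
  | MatchingTangle X Y => matching_tangle T k.+1 k X Y /\ k < pathwidth T
  | PathDecomposition Ws => path_decomposition T Ws /\ width Ws <= l + 2 * k
  end.

(* Main.v *)
Require Import Defs.
From mathcomp Require Import all_boot all_order all_algebra.
From mathcomp Require Import zify.
(* Again, so that mem is the memory of a state and not ssrbool's mem. *)
Import Defs.

Set Implicit Arguments.
Unset Strict Implicit.
Unset Printing Implicit Defensive.

(* Name the vertices by their position in an order by outdegree.  If some
   positions x and x + l + 1 have outdegrees differing by at most k, the
   positions in between form a degree tangle.  Otherwise let the cut i separate
   A = {0, ..., i} from B = {i + l + 1, ..., n - 1}; an arc from A to B then
   raises the outdegree by more than k, so k + 1 disjoint ones form a matching
   tangle.  For increasing i one maintains a matching M of arcs from A to B, a
   set D of dismissed vertices of A and a set P of essential vertices of B, such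
   that A - D is covered by M, and P contains every vertex of B with an arc from
   D and is matched into D.  So (A - D) and P cover all arcs across the cut and
   have at most |M| <= k elements each.  Passing to the next cut leaves at most
   two vertices of A - D unmatched, and each is either matched along an
   augmenting path or, when its alternating search tree S fails, dismissed
   together with S; a tree has at most k + 1 vertices of A, so the search takes
   O(k n) steps.  D and P only grow, hence the bags made of the l + 1 positions
   i, ..., i + l and of the covers of the cuts i - 1 and i form a path
   decomposition.

   That a tangle forces pathwidth > k follows from comparing outdegrees with the
   numbers of intervals ending before, or starting before, a given bag. *)

(** * Tangles exclude path decompositions of small width *)

Section Intervals.
Variables (V : finType) (T : rel V) (k : nat) (b e : V -> nat).
Hypotheses (irrT : simple T) (scT : semi_complete T).
Hypothesis le_be : forall v, b v <= e v.
Hypothesis arc_be : forall u v, T u v -> b v <= e u.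
Hypothesis card_bag : forall i, #|[set v | b v <= i <= e v]| <= k.+1.

(** Out-neighbours of [v] start no later than [v] ends, and so does [v] itself, which is not one of
    them; hence the strict inequality. *)
Lemma outdegree_lt v : outdegree T v < #|[set u | b u <= e v]|.
Proof.
apply: proper_card; apply/properP; split.
  by apply/subsetP => u; rewrite !inE => /arc_be.
by exists v; rewrite !inE ?le_be ?irrT.
Qed.

(** If [u] ends before [v] starts, the arc from [u] to [v] is impossible, and semi-completeness
    forces the one from [v] to [u]. *)
Lemma outdegree_ge v : #|[set u | e u < b v]| <= outdegree T v.
Proof.
apply: subset_leq_card; apply/subsetP => u; rewrite !inE => uv.
have nuv : v != u by apply: contraTneq uv => ->; rewrite -leqNgt le_be.
by case/orP: (scT nuv) => // /arc_be; rewrite leqNgt uv.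
Qed.

Lemma outdegree_gap v w :
  outdegree T w < outdegree T v + #|[set u | (b u <= e w) && (b v <= e u)]|.
Proof.
apply: (leq_trans (outdegree_lt w)).
apply: leq_trans (leq_add (outdegree_ge v) (leqnn _)).
rewrite -[leqRHS]addn0 -[X in _ <= _ + X](cards0 V).
apply: leq_trans (leq_trans (leq_card_setU _ _) (leq_addr _ _)).
apply: subset_leq_card; apply/subsetP => u; rewrite !inE => ->.
by case: ltnP.
Qed.

(** Let [al] end first and [be] start last in [X]. If they meet, [X] lies in one bag. Otherwise the
    part of [X] outside the bags at [e al] and [b be] lives strictly in between; [be] has arcs to it
    and to almost everything that started by [e al], a set larger than the outdegree of [al]. So
    [be] gains more than [k] over [al]. *)
Lemma interval_no_degree_tangle l X :
  5 * k <= l -> ~ degree_tangle T (l + 2) k X.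
Proof.
move=> lk [cX dX].
have [x0 x0X] : exists x, x \in X by apply/card_gt0P; lia.
case: (arg_minnP e x0X) => al alX minal.
case: (arg_maxnP b x0X) => be beX /= maxbe.
have bag_be := card_bag (b be); have bag_al := card_bag (e al).
case: (leqP (b be) (e al)) => [le|lt].
  have : #|X| <= #|[set v | b v <= b be <= e v]|.
    apply: subset_leq_card; apply/subsetP => u uX; rewrite inE.
    by move: (maxbe _ uX) (minal _ uX) => /=; lia.
  lia.
set A := [set u | b u <= e al]; set B := [set v | b v <= b be <= e v].
set C := [set v | b v <= e al <= e v].
(* The bag at [b be] contains [be], which is not in [A]; this gives [k] instead of [k + 1]. *)
have AB : #|A :&: B| <= k.
  rewrite -ltnS; apply: leq_trans bag_be; apply: proper_card.
  apply/properP; split; first exact: subsetIr.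
  by exists be; rewrite !inE ?leqnn ?le_be // leqNgt lt.
have AD : #|A :\: B| + #|X :\: (B :|: C)| <= outdegree T be.
  apply: leq_trans (outdegree_ge be).
  have disj : (A :\: B) :&: (X :\: (B :|: C)) = set0.
    apply/setP => u; rewrite !inE; apply/negP => /andP[h1 /andP[h2 uX]].
    by move: (minal _ uX) h1 h2; lia.
  rewrite -cardsUI disj cards0 addn0.
  apply: subset_leq_card; apply/subsetP => u; rewrite !inE.
  case/orP => [|/andP[h uX]]; first by lia.
  by move: (maxbe _ uX) h; lia.
have cBC : #|B :|: C| <= k.+1 + k.+1.
  exact: leq_trans (leq_card_setU _ _) (leq_add _ _).
have cA := cardsID B A; have cX' := cardsID (B :|: C) X.
have cXI : #|X :&: (B :|: C)| <= #|B :|: C| by apply: subset_leq_card; apply: subsetIr.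
have := outdegree_lt al; rewrite -/A => dal.
have := dX _ _ alX beX; lia.
Qed.

(* With p the last start in X and q the first end in Y, every bag between p and
   q meets all k+1 pairs, so it contains exactly one vertex of each and nothing
   else; hence every interval meeting [p, q] contains p. *)
Lemma interval_no_matching_tangle X Y : ~ matching_tangle T k.+1 k X Y.
Proof.
move=> [/pred0P dXY cX cY [f [injf fXY Tf]] degXY].
have [x0 x0X] : exists x, x \in X by apply/card_gt0P; lia.
have fY v : v \in X -> f v \in Y by move=> vX; rewrite -fXY imset_f.
case: (arg_maxnP b x0X) => v0 v0X /= maxv; case: (arg_minnP e (fY _ x0X)) => w0 w0Y minw.
have XY v w : v \in X -> w \in Y -> v != w.
  by move=> vX wY; apply: contraTneq wY => <-; have /= := dXY v; rewrite vX /= => ->.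
have := outdegree_gap v0 w0; have := degXY _ _ v0X w0Y.
suff: #|[set u | (b u <= e w0) && (b v0 <= e u)]| <= k.+1 by lia.
apply: leq_trans (card_bag (b v0)); apply: subset_leq_card; apply/subsetP => u.
rewrite !inE => /andP[uw uv].
case: (leqP (b u) (b v0)) => //= ltvu.
pose bag r := [set v | b v <= r <= e v].
pose g r v := if v \in bag r then v else f v.
(* If [v] has ended before [r], the arc from [v] to [f v] makes [f v] start before [r], and [f v]
   ends at [e w0] or later. *)
have gP r v : b v0 <= r <= e w0 -> v \in X -> g r v \in bag r.
  move=> pq vX; rewrite /g; case: ifP => // vr.
  have := Tf _ vX => /arc_be; move: vr (maxv _ vX) (minw _ (fY _ vX)).
  by rewrite !inE; lia.
have gI r : {in X &, injective (g r)}.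
  move=> v w vX wX; rewrite /g.
  case: ifP => _; case: ifP => _ // E.
  - by have := XY _ _ vX (fY _ wX); rewrite E eqxx.
  - by have := XY _ _ wX (fY _ vX); rewrite E eqxx.
  exact: injf.
have gE r : b v0 <= r <= e w0 -> g r @: X = bag r.
  move=> pq; apply/eqP; rewrite eqEcard card_in_imset // cX card_bag andbT.
  by apply/subsetP => _ /imsetP[v vX ->]; apply: gP.
have excl r v : b v0 <= r <= e w0 -> v \in X -> v \in bag r -> f v \notin bag r.
  move=> pq vX vr; rewrite -gE //; apply/imsetP => -[w wX].
  rewrite /g; case: ifP => wr E.
    by have := XY _ _ wX (fY _ vX); rewrite E eqxx.
  by move: wr; rewrite -(injf _ _ vX wX E) vr.
have ur : u \in bag (b u) by rewrite inE leqnn le_be.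
have: u \in g (b u) @: X by rewrite gE // uw ltnW.
(* Since [u] starts after [b v0], it is not in [X]; thus [u = f v] with [v] outside this bag. But
   [v] starts by [b v0], and its arc to [u] keeps it alive until [b u], a contradiction. *)
case/imsetP => v vX; rewrite /g; case: ifP => vr E.
  by move: (maxv _ vX); rewrite -E; lia.
have := excl (b u) v; rewrite uw (ltnW ltvu) -E => /(_ isT vX).
have := arc_be (Tf _ vX); rewrite -E.
by move: vr (maxv _ vX); rewrite !inE; lia.
Qed.

End Intervals.

Section Pathwidth.
Variables (V : finType) (T : rel V) (k : nat).
Hypotheses (irrT : simple T) (scT : semi_complete T).

(** Condition (ii) makes the bags containing a vertex consecutive; [b] and [e] are the indices of
    the first and the last one, and condition (iii) then yields [b v <= e u]. *)
Lemma pathwidth_intervals : pathwidth T <= k ->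
  exists b e : V -> nat,
  [/\ forall v, b v <= e v,
      forall u v, T u v -> b v <= e u
    & forall i, #|[set v | b v <= i <= e v]| <= k.+1].
Proof.
rewrite /pathwidth; case: ex_minnP => w /boolp.asboolP[Ws [covW itvW arcW] wW _] wk.
pose bag i := nth set0 Ws i.
have bag_size v i : v \in bag i -> i < size Ws.
  by case: ltnP => // sz; rewrite /bag nth_default // inE.
have itv v : exists be : nat * nat,
    be.1 <= be.2 /\ forall i, (v \in bag i) = (be.1 <= i <= be.2).
  have ex : exists i, v \in bag i.
    have: v \in \bigcup_(W <- Ws) W by rewrite covW inE.
    rewrite (big_nth set0) big_mkord => /bigcupP[i _ vi]; by exists i.
  have ub i : v \in bag i -> i <= size Ws by move/bag_size/ltnW.
  case: (ex_minnP ex) => i vi mini; case: (ex_maxnP ex ub) => j vj maxj.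
  exists (i, j); split => [|r]; first exact: mini.
  apply/idP/andP => /= [vr|[ir rj]]; first by rewrite mini ?maxj.
  move: ir; rewrite leq_eqVlt => /predU1P[<- //|ir].
  move: rj; rewrite leq_eqVlt => /predU1P[-> //|rj].
  by apply: (subsetP (itvW _ _ _ ir rj (bag_size _ _ vj))); rewrite inE; apply/andP.
have [be beP] := fin_all_exists itv.
exists (fun v => (be v).1), (fun v => (be v).2); split=> [v|u v Tuv|i].
- by case: (beP v).
- case: (arcW _ _ Tuv) => [[i [_ ui vi]]|[i [j [ji _ ui vj]]]].
    by move: ui vi; rewrite (beP u).2 (beP v).2; lia.
  by move: ui vj; rewrite (beP u).2 (beP v).2; lia.
have -> : [set v | (be v).1 <= i <= (be v).2] = bag i.
  by apply/setP => v; rewrite inE (beP v).2.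
case: (ltnP i (size Ws)) => [szi|szi]; last by rewrite /bag nth_default // cards0.
apply: leq_trans (leqSpred _) _; rewrite ltnS; apply: leq_trans wk.
rewrite -wW /width (big_nth set0) big_mkord.
exact: (leq_bigmax (F := fun j : 'I_(size Ws) => #|nth set0 Ws j|.-1) (Ordinal szi)).
Qed.

Lemma degree_tangle_pathwidth l X :
  5 * k <= l -> degree_tangle T (l + 2) k X -> k < pathwidth T.
Proof.
move=> lk tgl; rewrite ltnNge; apply/negP => /pathwidth_intervals[b [e [be arc card]]].
exact: (interval_no_degree_tangle irrT scT be arc card lk) tgl.
Qed.

Lemma matching_tangle_pathwidth X Y :
  matching_tangle T k.+1 k X Y -> k < pathwidth T.
Proof.
move=> tgl; rewrite ltnNge; apply/negP => /pathwidth_intervals[b [e [be arc card]]].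
exact: (interval_no_matching_tangle irrT scT be arc card) tgl.
Qed.

End Pathwidth.

(** * Program logic *)

Definition run (c : cmd) (s : state) (Q : state -> nat -> Prop) : Prop :=
  exists s' t, exec c s s' t /\ Q s' t.

Fixpoint writes (c : cmd) : seq nat :=
  match c with
  | Write a _ _ => [:: a]
  | Seq c1 c2 | If _ c1 c2 => writes c1 ++ writes c2
  | While _ c => writes c
  | _ => [::]
  end.

Fixpoint emits (c : cmd) : bool :=
  match c with
  | Emit _ => true
  | Seq c1 c2 | If _ c1 c2 => emits c1 || emits c2
  | While _ c => emits c
  | _ => false
  end.

(** A syntactic frame condition. It carries facts about untouched arrays past a command, so that
    loop invariants need not repeat them. *)
Definition frame (c : cmd) (s s' : state) : Prop :=
  (forall a, a \notin writes c -> mem s' a = mem s a) /\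
  (~~ emits c -> tape s' = tape s).

Lemma frame_trans c s1 s2 s3 : frame c s1 s2 -> frame c s2 s3 -> frame c s1 s3.
Proof.
move=> [m12 t12] [m23 t23]; split=> [a ac|ec]; first by rewrite m23 ?m12.
by rewrite t23 ?t12.
Qed.

Lemma frame_seql c1 c2 s s' : frame c1 s s' -> frame (Seq c1 c2) s s'.
Proof.
move=> [m1 h1]; split=> [a|] /=; first by rewrite mem_cat => /norP[/m1].
by move=> /norP[/h1].
Qed.

Lemma exec_frame c s s' t : exec c s s' t -> frame c s s'.
Proof.
elim=> //= {c s s' t}.
- move=> a i e s; split=> //= b; rewrite inE => /negbTE ba.
  by rewrite /upd ba.
- move=> c1 c2 s1 s2 s3 t1 t2 _ [m1 h1] _ [m2 h2]; split=> [a|] /=.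
    by rewrite mem_cat => /norP[a1 a2]; rewrite m2 ?m1.
  by move=> /norP[a1 a2]; rewrite h2 ?h1.
- move=> e c1 c2 s s' t _ _ [m1 h1]; split=> [a|] /=.
    by rewrite mem_cat => /norP[a1 _]; exact: m1.
  by move=> /norP[a1 _]; exact: h1.
- move=> e c1 c2 s s' t _ _ [m1 h1]; split=> [a|] /=.
    by rewrite mem_cat => /norP[_ a1]; exact: m1.
  by move=> /norP[_ a1]; exact: h1.
- by move=> e c s1 s2 s3 t1 t2 _ _ f1 _ f2; exact: frame_trans f1 f2.
Qed.

Lemma run_conseq c s (P Q : state -> nat -> Prop) :
  run c s P -> (forall s' t, frame c s s' -> P s' t -> Q s' t) -> run c s Q.
Proof.
by move=> [s' [t [ex h]]] PQ; exists s', t; split=> //; apply/PQ/h/(exec_frame ex).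
Qed.

Lemma run_skip s (Q : state -> nat -> Prop) : Q s 1 -> run Skip s Q.
Proof. by move=> h; exists s, 1; split=> //; constructor. Qed.

Lemma run_write a i e s (Q : state -> nat -> Prop) :
  Q (State (upd (mem s) a (eval (mem s) i) (eval (mem s) e)) (tape s))
    (ecost i + ecost e).+1 ->
  run (Write a i e) s Q.
Proof. by move=> h; eexists; eexists; split; [exact: exec_Write|]. Qed.

Lemma run_emit e s (Q : state -> nat -> Prop) :
  Q (State (mem s) (rcons (tape s) (eval (mem s) e))) (ecost e).+1 ->
  run (Emit e) s Q.
Proof. by move=> h; eexists; eexists; split; [exact: exec_Emit|]. Qed.

Lemma run_seq c1 c2 s (Q : state -> nat -> Prop) :
  run c1 s (fun s1 t1 => run c2 s1 (fun s2 t2 => Q s2 (t1 + t2))) ->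
  run (Seq c1 c2) s Q.
Proof.
move=> [s1 [t1 [ex1 [s2 [t2 [ex2 h]]]]]]; exists s2, (t1 + t2); split=> //.
exact: exec_Seq ex1 ex2.
Qed.

Lemma run_if e c1 c2 s (Q : state -> nat -> Prop) :
  (eval (mem s) e != 0 -> run c1 s (fun s' t => Q s' (ecost e + t).+1)) ->
  (eval (mem s) e = 0 -> run c2 s (fun s' t => Q s' (ecost e + t).+1)) ->
  run (If e c1 c2) s Q.
Proof.
move=> h1 h2; have [e0|e0] := eqVneq (eval (mem s) e) 0.
  have [s' [t [ex h]]] := h2 e0; exists s', (ecost e + t).+1.
  by split=> //; apply: exec_IfF.
have [s' [t [ex h]]] := h1 e0; exists s', (ecost e + t).+1.
by split=> //; apply: exec_IfT.
Qed.

(** The measure [mu] drops in every round, so there are at most [mu s] rounds, each paying for the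
    body and a test; one more test ends the loop. *)
Lemma run_while e c s (I : state -> Prop) (mu : state -> nat) B
    (Q : state -> nat -> Prop) :
  I s ->
  (forall s1, I s1 -> frame c s s1 -> eval (mem s1) e != 0 ->
    run c s1 (fun s2 t => [/\ I s2, mu s2 < mu s1 & t <= B])) ->
  (forall s' t, I s' -> frame c s s' -> eval (mem s') e = 0 ->
    t <= mu s * (B + (ecost e).+1) + (ecost e).+1 -> Q s' t) ->
  run (While e c) s Q.
Proof.
move=> I0 step fin.
suff: forall d s1, mu s1 <= d -> I s1 -> frame c s s1 ->
    run (While e c) s1 (fun s' t =>
      [/\ I s', frame c s s', eval (mem s') e = 0
        & t <= d * (B + (ecost e).+1) + (ecost e).+1]).
  move=> /(_ _ _ (leqnn (mu s)) I0); case=> // s' [t [ex [h1 h2 h3 h4]]].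
  by exists s', t; split=> //; exact: fin.
elim=> [|d IH] s1 mud I1 fr; have [e0|e0] := eqVneq (eval (mem s1) e) 0.
- by exists s1, (ecost e).+1; split; [exact: exec_WhileF | split=> //; lia].
- by have [s2 [t [_ [_]]]] := step _ I1 fr e0; lia.
- by exists s1, (ecost e).+1; split; [exact: exec_WhileF | split=> //; lia].
have [s2 [t1 [ex1 [I2 mu2 tB]]]] := step _ I1 fr e0.
have fr2 := frame_trans fr (exec_frame ex1).
have [|s3 [t2 [ex2 [I3 fr3 e3 t2B]]]] := IH s2 _ I2 fr2; first by lia.
exists s3, (ecost e + t1 + t2).+1; split; first exact: exec_WhileT ex1 ex2.
by split=> //; rewrite mulSn; lia.
Qed.

Local Notation "c1 ;; c2" := (Seq c1 c2) (at level 70, right associativity).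

Definition var (a : nat) : expr := Read a (Num 0).

Definition assign (a : nat) (e : expr) : cmd := Write a (Num 0) e.

Definition For (v : nat) (lo hi : expr) (c : cmd) : cmd :=
  assign v lo ;; While (Sub hi (var v)) (c ;; assign v (Add (var v) (Num 1))).

(** [I j] speaks of the state whose counter already holds [j], so the body has to prepare [I j.+1]
    for the state after the increment. The final index is [maxn l0 h] because the loop may be empty.
    The constants 10 and 6 pay for increment, tests and initialisation. *)
Lemma run_for v lo hi c s h (I : nat -> state -> Prop) B
    (Q : state -> nat -> Prop) :
  let l0 := eval (mem s) lo in
  v \notin writes c ->
  (forall s1, frame (For v lo hi c) s s1 -> eval (mem s1) hi = h) ->
  I l0 (State (upd (mem s) v 0 l0) (tape s)) ->
  (forall j s1, l0 <= j < h -> mem s1 v 0 = j -> I j s1 ->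
    frame (For v lo hi c) s s1 ->
    run c s1 (fun s2 t =>
      I j.+1 (State (upd (mem s2) v 0 j.+1) (tape s2)) /\ t <= B)) ->
  (forall s' t, I (maxn l0 h) s' -> frame (For v lo hi c) s s' ->
    t <= (h - l0) * (B + (ecost hi + 10)) + (ecost lo + ecost hi + 6) ->
    Q s' t) ->
  run (For v lo hi c) s Q.
Proof.
move=> l0 vc hiE I0 step fin; apply/run_seq/run_write => /=.
set s0 := State _ _; rewrite -/l0 in s0 *.
have fr0 s1 : frame (c ;; assign v (Add (var v) (Num 1))) s0 s1 ->
    frame (For v lo hi c) s s1.
  move=> [fm ft]; split=> [a|] /=.
    rewrite inE => /norP[av ac]; rewrite fm //=.
    by rewrite /upd (negbTE av).
  by move=> ec; rewrite ft.
apply: (@run_while _ _ s0 (fun s1 => exists j,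
    [/\ l0 <= j <= maxn l0 h, mem s1 v 0 = j & I j s1])
    (fun s1 => h - mem s1 v 0) (B + 6)).
- by exists l0; split=> //; [lia | rewrite /= /upd !eqxx].
- move=> s1 [j [jl vj Ij]] /fr0 fr1 /=; rewrite (hiE _ fr1) vj => jh.
  have jlt : l0 <= j < h by lia.
  apply/run_seq/(run_conseq (step _ _ jlt vj Ij fr1)) => s2 t [fm _] [I2 tB].
  apply: run_write; rewrite /= fm // vj addn1 /upd !eqxx /=; split; [|lia|lia].
  by exists j.+1; split=> //; lia.
move=> s' t [j [jl vj Ij]] /fr0 fr1 /=; rewrite (hiE _ fr1) vj => jh tB.
apply: fin => //.
  by have -> : maxn l0 h = j by lia.
by move: tB; rewrite /upd !eqxx /=; lia.
Qed.

(** * Matchings and covers across the cuts *)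

Definition upd1 (f : nat -> nat) (i x : nat) : nat -> nat :=
  fun j => if j == i then x else f j.

Lemma upd1E f i x j : upd1 f i x j = if j == i then x else f j.
Proof. by []. Qed.

Lemma count_change (S : eqType) (p q : pred S) (x : S) (s : seq S) :
  uniq s -> x \in s -> (forall y, y != x -> p y = q y) ->
  count p s + q x = count q s + p x.
Proof.
move=> us xs pq; rewrite !(permP (perm_to_rem xs)) /=.
have -> : count p (rem x s) = count q (rem x s).
  apply: eq_in_count => y; rewrite (rem_filter _ us) mem_filter => /andP[yx _].
  exact: pq.
lia.
Qed.

Section Cuts.
Variables (n l : nat) (adj : rel nat).

(* Partners are stored plus one, 0 meaning unmatched. *)
Definition matching al be (mA mB : nat -> nat) :=
  (forall a b, mA a = b.+1 <-> mB b = a.+1) /\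
  (forall a b, mA a = b.+1 -> [/\ a < al, be <= b, b < n & adj a b]).

Definition nmatched (mA : nat -> nat) := count (fun a => mA a != 0) (iota 0 n).

Lemma nmatched_le mA : nmatched mA <= n.
Proof. by rewrite /nmatched -[leqRHS](size_iota 0 n); apply: count_size. Qed.

Lemma nmatched_upd mA a x : a < n ->
  nmatched (upd1 mA a x) + (mA a != 0) = nmatched mA + (x != 0).
Proof.
move=> an; rewrite /nmatched (@count_change _ _ (fun a => mA a != 0) a) ?iota_uniq //.
- by rewrite upd1E eqxx.
- by rewrite mem_iota.
by move=> y /negbTE ya; rewrite upd1E ya.
Qed.

(** One flip along an augmenting path: [a] drops [b'] for the free [b], and [b'] becomes the new
    free end. *)
Lemma matching_swap al be mA mB a b b' :
  matching al be mA mB -> al <= n -> mA a = b'.+1 -> mB b = 0 ->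
  be <= b < n -> adj a b ->
  matching al be (upd1 mA a b.+1) (upd1 (upd1 mB b a.+1) b' 0) /\
  nmatched (upd1 mA a b.+1) = nmatched mA.
Proof.
move=> [mm mr] aln ab' b0 bn adjab; have [aal b'be b'n adjab'] := mr _ _ ab'.
have b'a := (mm _ _).1 ab'.
split; last by have := nmatched_upd mA b.+1 (leq_trans aal aln); rewrite ab'; lia.
split=> [x y|x y]; rewrite !upd1E; last first.
  case: eqVneq => [-> [<-]|_ /mr //]; by split=> //; lia.
have [->|xa] := eqVneq x a.
  have [->|yb'] := eqVneq y b'.
    by split=> // -[E]; move: b0; rewrite E b'a.
  have [->|yb] := eqVneq y b; first by [].
  split=> [[E]|/mm]; first by rewrite E eqxx in yb.
  by rewrite ab' => -[E]; rewrite E eqxx in yb'.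
have [->|yb'] := eqVneq y b'.
  by split=> // /mm; rewrite b'a => -[E]; rewrite E eqxx in xa.
have [->|yb] := eqVneq y b.
  split=> [/mm|[E]]; first by rewrite b0.
  by rewrite E eqxx in xa.
exact: mm.
Qed.

Lemma matching_add al be mA mB a b :
  matching al be mA mB -> al <= n -> a < al -> mA a = 0 -> mB b = 0 ->
  be <= b < n -> adj a b ->
  matching al be (upd1 mA a b.+1) (upd1 mB b a.+1) /\
  nmatched (upd1 mA a b.+1) = (nmatched mA).+1.
Proof.
move=> [mm mr] aln aal a0 b0 bn adjab.
split; last by have := nmatched_upd mA b.+1 (leq_trans aal aln); rewrite a0; lia.
split=> [x y|x y]; rewrite !upd1E; last first.
  case: eqVneq => [-> [<-]|_ /mr //]; by split=> //; lia.
have [->|xa] := eqVneq x a; have [->|yb] := eqVneq y b.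
- by [].
- split=> [[E]|/mm]; first by rewrite E eqxx in yb.
  by rewrite a0.
- split=> [/mm|[E]]; first by rewrite b0.
  by rewrite E eqxx in xa.
exact: mm.
Qed.

(** Moving the cut takes [be] out of B, which releases its mate [a]. *)
Lemma matching_del al be mA mB a :
  matching al be mA mB -> al <= n -> mB be = a.+1 ->
  [/\ matching al be.+1 (upd1 mA a 0) (upd1 mB be 0), a < al, adj a be
    & (nmatched (upd1 mA a 0)).+1 = nmatched mA].
Proof.
move=> [mm mr] aln ba; have ab := (mm _ _).2 ba.
have [aal _ bn adjab] := mr _ _ ab.
split=> //; last by have := nmatched_upd mA 0 (leq_trans aal aln); rewrite ab; lia.
split=> [x y|x y]; rewrite !upd1E; last first.
  case: eqVneq => // xa xy; have [x1 y1 yn axy] := mr _ _ xy; split=> //.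
  rewrite ltn_neqAle y1 andbT; apply: contra_neq xa => E.
  by move: xy; rewrite -E => /mm; rewrite ba => -[].
have [->|xa] := eqVneq x a; have [->|yb] := eqVneq y be; split=> //.
- by move/mm; rewrite ab => -[E]; rewrite E eqxx in yb.
- by move/mm; rewrite ba => -[E]; rewrite E eqxx in xa.
- by move/mm.
by move/mm.
Qed.

(* hi a is the cut at which a was dismissed, and n before that; lo b is the cut
   at which b became essential, and b - l before that.  Position j will be put
   into the bags lo j, ..., hi j. *)
Definition labels al i (lo hi : nat -> nat) :=
  [/\ forall a, a < n -> hi a = n \/ [/\ a < al, a <= hi a & hi a < i],
      forall b, b < n -> lo b = b - l \/ (lo b < i /\ lo b + l < b)
    & forall a b, a < n -> b < n -> adj a b -> lo b <= hi a].

(** [r] is the single undismissed vertex of A that may lack a mate, with [r = n] when there is none.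
    [lo b + l < b] expresses that [b] is essential, so the second clause matches P into D. *)
Definition covered al be r (lo hi mA mB : nat -> nat) :=
  (forall a, a < al -> hi a = n -> a != r -> mA a != 0) /\
  (forall b, be <= b < n -> lo b + l < b -> exists2 a, mB b = a.+1 & hi a < n).

(* Changing lo, hi into lo', hi' leaves the covers of the cuts before i alone. *)
Definition agree i (lo hi lo' hi' : nat -> nat) :=
  (forall i' a, i' < i -> a < n -> (i' < hi' a) = (i' < hi a)) /\
  (forall i' b, i' < i -> b < n -> (lo' b <= i') = (lo b <= i')).

(** The situation in which a search starts at cut [i]. Here [al] is [i] when the root lost its mate
    to the shift of B, and [i.+1] when the root is the position [i] just added to A. *)
Record search_pre i al r (lo hi mA mB : nat -> nat) : Prop := SearchPre {
  pre_lab : labels al i.+1 lo hi;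
  pre_mat : matching al (i + l + 1) mA mB;
  pre_cov : covered al (i + l + 1) r lo hi mA mB;
  pre_root : r < al;
  pre_al : al <= i.+1;
  pre_be : i + l + 1 < n;
  pre_free : mA r = 0;
  pre_hi : hi r = n }.

(** * Alternating search from an unmatched vertex *)

Section Search.
Variables (i al r : nat) (lo hi mA mB : nat -> nat).
Let be := i + l + 1.
Hypothesis pre : search_pre i al r lo hi mA mB.
Let lab := pre_lab pre.
Let mat := pre_mat pre.
Let cov := pre_cov pre.
Let ral := pre_root pre.
Let ali := pre_al pre.
Let ben := pre_be pre.
Let r0 := pre_free pre.
Let hir := pre_hi pre.

Let perm b := lo b + l < b.

(* par b is the place in the queue of the vertex from which b was reached. *)
Record searching (vis par que : nat -> nat) (qt fnd : nat) : Prop := Searching {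
  que0 : que 0 = r;
  qt_gt0 : 0 < qt;
  que_lt : forall p, p < qt -> que p < al /\ hi (que p) = n;
  que_inj : forall p q, p < qt -> q < qt -> que p = que q -> p = q;
  que_mate : forall p, 0 < p < qt -> exists b,
    [/\ mA (que p) = b.+1, vis b != 0, ~~ perm b & par b < p];
  vis_perm : forall b, b < n -> perm b -> vis b != 0;
  vis_new : forall b, be <= b < n -> vis b != 0 -> ~~ perm b ->
    [/\ par b < qt, adj (que (par b)) b
      & (mB b = 0 /\ fnd != 0) \/ exists2 p, p < qt & mB b = (que p).+1];
  fndP : forall b, fnd = b.+1 ->
    [/\ be <= b < n, vis b != 0, ~~ perm b & mB b = 0] }.

Lemma searching_init vis par que :
  (forall b, b < n -> vis b = b - (lo b + l)) -> que 0 = r ->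
  searching vis par que 1 0.
Proof.
move=> visE q0; split=> //.
- by move=> [|p] // _; rewrite q0.
- by move=> [|p] [|q].
- by move=> [|p].
- by move=> b bn pb; rewrite visE //; move: pb; rewrite /perm; lia.
by move=> b bn; rewrite visE /perm; lia.
Qed.

(** The tree never enters D: an inessential [z] of B has [lo z > i], while a dismissed mate would
    have [hi a <= i], against the arc inequality of the labels. *)
Lemma mate_undismissed z a : be <= z < n -> ~~ perm z -> mB z = a.+1 ->
  a < al /\ hi a = n.
Proof.
move=> zn pz /(mat.1 _ _).2 az; have [aal _ _ adjaz] := mat.2 _ _ az.
have [hiP _ arcs] := lab; have an : a < n by lia.
split=> //; case: (hiP _ an) => // -[_ _ hai].
by have := arcs _ _ an (proj2 (andP zn)) adjaz; move: pz; rewrite /perm; lia.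
Qed.

Lemma searching_push vis par que qt fnd qh z a :
  searching vis par que qt fnd -> qh < qt -> be <= z < n -> vis z = 0 ->
  adj (que qh) z -> mB z = a.+1 ->
  searching (upd1 vis z 1) (upd1 par z qh) (upd1 que qt a) qt.+1 fnd.
Proof.
move=> S qhqt zn visz adjz za; have az := (mat.1 _ _).2 za.
have pz : ~~ perm z.
  by apply/negP => /(vis_perm S (proj2 (andP zn))); rewrite visz.
have [aal hia] := mate_undismissed zn pz za.
(* The pushed vertex is new: the root has no mate, and the mates of the other queued vertices are
   already visited, unlike [z]. *)
have qa p : p < qt -> que p != a.
  move=> pqt; apply: contra_eq_neq az => <-.
  case: (posnP p) => [->|p0]; first by rewrite (que0 S) r0.
  have [|b [-> visb _ _]] := que_mate S (p := p); first by lia.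
  by apply: contraNneq visb => -[->]; rewrite visz.
have quE p : p < qt -> upd1 que qt a p = que p by move=> ?; rewrite upd1E ltn_eqF.
have qqt : upd1 que qt a qt = a by rewrite upd1E eqxx.
have visn b : vis b != 0 -> b != z by apply: contraNneq => ->; rewrite visz.
split.
- by rewrite quE ?(que0 S) ?(qt_gt0 S).
- by [].
- move=> p; rewrite ltnS leq_eqVlt => /predU1P[->|pqt]; first by rewrite qqt.
  by rewrite quE //; exact: (que_lt S).
- move=> p q; rewrite !ltnS leq_eqVlt => /predU1P[->|pqt];
    rewrite leq_eqVlt => /predU1P[->|qqt']; rewrite ?qqt ?quE //.
  + by move=> E; have := qa _ qqt'; rewrite E eqxx.
  + by move=> E; have := qa _ pqt; rewrite E eqxx.
  exact: (que_inj S).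
- move=> p /andP[p0]; rewrite ltnS leq_eqVlt => /predU1P[->|pqt].
    by exists z; rewrite qqt !upd1E eqxx.
  have [|b [ab visb pb parb]] := que_mate S (p := p); first by lia.
  by exists b; rewrite quE // !upd1E !(negbTE (visn _ visb)).
- by move=> b bn pb; rewrite upd1E; case: (eqVneq b z) => // _; exact: (vis_perm S).
- move=> b bn; rewrite (upd1E vis) (upd1E par); case: (eqVneq b z) => [-> _ _|bz visb pb].
    rewrite quE //; split=> //; first by lia.
    by right; exists qt => //; rewrite qqt.
  have [h1 h2 h3] := vis_new S bn visb pb; rewrite quE //; split=> //; first by lia.
  case: h3 => [|[p pqt E]]; first by left.
  by right; exists p; rewrite ?quE //; lia.
move=> b /(fndP S)[h1 h2 h3 h4]; split=> //; rewrite upd1E.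
by case: (eqVneq b z).
Qed.

Lemma searching_free vis par que qt fnd qh z :
  searching vis par que qt fnd -> qh < qt -> be <= z < n -> vis z = 0 ->
  adj (que qh) z -> mB z = 0 ->
  searching (upd1 vis z 1) (upd1 par z qh) que qt z.+1.
Proof.
move=> S qhqt zn visz adjz za.
have pz : ~~ perm z.
  by apply/negP => /(vis_perm S (proj2 (andP zn))); rewrite visz.
have visn b : vis b != 0 -> b != z by apply: contraNneq => ->; rewrite visz.
split; [exact: (que0 S) | exact: (qt_gt0 S) | exact: (que_lt S) | exact: (que_inj S) | | | |].
- move=> p pqt; have [b [ab visb pb parb]] := que_mate S pqt.
  by exists b; rewrite !upd1E !(negbTE (visn _ visb)).
- by move=> b bn pb; rewrite upd1E; case: (eqVneq b z) => // _; exact: (vis_perm S).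
- move=> b bn; rewrite !upd1E; case: (eqVneq b z) => [-> _ _|bz visb pb].
    by split=> //; left.
  have [h1 h2 h3] := vis_new S bn visb pb; split=> //.
  by case: h3 => [[]|]; [left | right].
by move=> b [<-]; rewrite upd1E eqxx.
Qed.

(** Apart from the root, the queued vertices are distinct and matched. *)
Lemma queue_bound vis par que qt fnd :
  searching vis par que qt fnd -> qt <= (nmatched mA).+1.
Proof.
move=> S; have qt0 := qt_gt0 S.
suff: size [seq que p | p <- iota 1 qt.-1] <= nmatched mA.
  by rewrite size_map size_iota; lia.
rewrite /nmatched -size_filter; apply: uniq_leq_size.
  rewrite map_inj_in_uniq ?iota_uniq // => p q; rewrite !mem_iota => pP qP.
  by apply: (que_inj S); lia.
move=> _ /mapP[p + ->]; rewrite mem_iota mem_filter mem_iota => pP.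
have [|b [-> _ _ _]] := que_mate S (p := p); first by lia.
by have [|] := que_lt S (p := p); lia.
Qed.

(** The quantified pairs precede [(qh, z)] in the lexicographic order of the scan. With [z = be]
    these are the pairs with a place below [qh]. *)
Definition explored (que vis : nat -> nat) qh z :=
  forall p b, p <= qh -> be <= b < n -> (p < qh) || (b < z) -> adj (que p) b ->
  vis b != 0.

Lemma explored_skip que vis qh z :
  explored que vis qh z -> vis z != 0 \/ ~~ adj (que qh) z ->
  explored que vis qh z.+1.
Proof.
move=> ex vz p b pq bn pz adjb.
case: (boolP ((p < qh) || (b < z))) => [h|nh]; first exact: ex pq bn h adjb.
have Ep : p = qh by lia.
have Eb : b = z by lia.
by case: vz; rewrite -?Ep -Eb ?adjb.
Qed.

Lemma explored_visit que vis qh z qt a :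
  explored que vis qh z -> qh < qt ->
  explored (upd1 que qt a) (upd1 vis z 1) qh z.+1.
Proof.
move=> ex qq p b pq bn bz; rewrite !upd1E ltn_eqF ?(leq_ltn_trans pq) // => adjb.
by case: (eqVneq b z) => // bz'; apply: ex pq bn _ adjb; lia.
Qed.

Lemma explored_next que vis qh : explored que vis qh n -> explored que vis qh.+1 be.
Proof.
move=> ex p b pq bn; rewrite ltnS (_ : b < be = false); last by lia.
by rewrite orbF => pq'; apply: ex => //; rewrite (proj2 (andP bn)) orbT.
Qed.

(** The queue is dismissed and the visited vertices become essential. An arc leaving the queue ends
    below [be] or in a visited vertex, so its head has [lo' b <= i]; and since nothing free was
    found, every newly essential vertex has its mate in the queue. Labels [lo b = b - l > i] and
    [hi a = n] drop to [i], which no cut before [i] can notice. *)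
Lemma search_fail vis par que qt lo' hi' :
  searching vis par que qt 0 -> explored que vis qt be ->
  (forall a, a < n -> hi' a = if a \in mkseq que qt then i else hi a) ->
  (forall b, b < n -> lo' b =
    if [&& be <= b, vis b != 0 & ~~ perm b] then i else lo b) ->
  [/\ labels al i.+1 lo' hi', covered al be n lo' hi' mA mB
    & agree i lo hi lo' hi'].
Proof.
move=> S ex hiE loE; have [hiP loP arcs] := lab.
have queP a : a \in mkseq que qt -> [/\ exists2 p, p < qt & a = que p, a < al & hi a = n].
  move=> /mapP[p]; rewrite mem_iota => pq ->.
  by have [|? ?] := que_lt S (p := p); [lia | split=> //; exists p => //; lia].
have loN b : b < n -> ~~ perm b -> lo b = b - l.
  by move=> bn; case: (loP _ bn) => // -[_]; rewrite /perm => ->.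
split.
- split=> [a an|b bn|a b an bn adjab].
  + rewrite hiE //; case: ifP => [/queP[_ aal _]|_]; last exact: hiP.
    by right; split=> //; lia.
  + rewrite loE //; case: ifP => [/and3P[b1 _ _]|_]; last exact: loP.
    by right; split=> //; rewrite /be in b1; lia.
  rewrite hiE // loE //; move: adjab; case: (boolP (a \in _)) => [/queP[[p pqt ->] _ _] adjab|_ adjab].
    case: ifP => // /negbT; have := loP _ bn.
    have [bbe|bbe] := leqP be b; last by rewrite /be in bbe; lia.
    rewrite (ex p) ?pqt ?(ltnW pqt) //=; last by lia.
    by rewrite negbK /perm; rewrite /be in bbe; lia.
  (* For a tail outside the queue, lowering [lo b] from [b - l] to [i] only weakens the
     condition. *)
  case: ifP => [/and3P[b1 _ pb]|_]; last exact: arcs.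
  have := arcs _ _ an bn adjab; rewrite (loN _ bn pb).
  by rewrite /be in b1; lia.
- split=> [a aal|b /andP[b1 bn]].
    have an : a < n by lia.
    rewrite hiE //; case: ifP => [_|aq]; first by lia.
    move=> hia _; apply: cov.1 => //; apply: contraFneq aq => ->.
    by rewrite -(que0 S); apply: map_f; rewrite mem_iota (qt_gt0 S).
  rewrite loE // b1 /=; have hi'n a : a < n -> hi a < n -> hi' a < n.
    by move=> an han; rewrite hiE //; case: ifP => // _; lia.
  have bbn : be <= b < n by rewrite b1.
  have mBn a : mB b = a.+1 -> a < n.
    by move/(mat.1 _ _).2/(mat.2 _ _) => -[+ _ _ _]; lia.
  case: ifP => [/andP[visb pb] _|_ pb].
    have [_ _ [[_]//|[p pqt E]]] := vis_new S bbn visb pb.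
    exists (que p) => //; rewrite hiE ?(mBn _ E) //.
    by rewrite map_f ?mem_iota //; lia.
  have [a E ha] := cov.2 _ bbn pb; exists a => //; apply: hi'n => //.
  exact: mBn.
split=> [i' a i'i an|i' b i'i bn].
  rewrite hiE //; case: ifP => [/queP[_ _ ->]|//]; lia.
rewrite loE //; case: ifP => [/and3P[b1 _ pb]|//]; rewrite (loN _ bn pb).
by rewrite /be in b1; lia.
Qed.

(* The matching after flipping the path up to b, which is now free and reached
   from que p. *)
Record augmenting (par que : nat -> nat) (qt b p : nat) (mA' mB' : nat -> nat) :
    Prop := Augmenting {
  aug_mat : matching al be mA' mB';
  aug_cov : covered al be r lo hi mA' mB';
  aug_num : nmatched mA' = nmatched mA;
  aug_root : mA' r = 0;
  aug_free : mB' b = 0;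
  aug_range : be <= b < n;
  aug_perm : ~~ perm b;
  aug_qt : p < qt;
  aug_adj : adj (que p) b;
  aug_path : forall q, 0 < q <= p -> exists b',
    [/\ mA' (que q) = b'.+1, par b' < q, adj (que (par b')) b' & ~~ perm b'] }.

Lemma augmenting_init vis par que qt b :
  searching vis par que qt b.+1 -> augmenting par que qt b (par b) mA mB.
Proof.
move=> S; have [bn visb pb b0] := fndP S erefl.
have [h1 h2 _] := vis_new S bn visb pb.
split=> // q qp; have [|b' [qb' visb' pb' parb']] := que_mate S (p := q); first by lia.
have [_ h3 h4 _] := mat.2 _ _ qb'.
have [|_ h6 _] := vis_new S _ visb' pb'; first by rewrite h3.
by exists b'.
Qed.

(** Flipped vertices stand at places from [p] upwards, and the path goes on at [par b' < p]; hence
    the tree edges still ahead are intact and the walk terminates. *)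
Lemma augmenting_step vis par que qt fnd b p mA' mB' b' :
  searching vis par que qt fnd -> augmenting par que qt b p mA' mB' ->
  mA' (que p) = b'.+1 ->
  par b' < p /\
  augmenting par que qt b' (par b')
    (upd1 mA' (que p) b.+1) (upd1 (upd1 mB' b (que p).+1) b' 0).
Proof.
move=> S A pb'; have p0 : 0 < p.
  by case: (posnP p) => // p0; move: pb'; rewrite p0 (que0 S) (aug_root A).
have aln : al <= n by lia.
have [|b2 [E parb' adjb' permb']] := aug_path A (q := p); first by lia.
move: E; rewrite pb' => -[E]; subst b2; split=> //.
have [mat' num'] := matching_swap (aug_mat A) aln pb' (aug_free A) (aug_range A) (aug_adj A).
have qr : que p != r.
  apply/eqP; rewrite -(que0 S) => /(que_inj S (aug_qt A) (qt_gt0 S)) p0'.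
  by rewrite p0' in p0.
have [_ b'1 b'2 _] := (aug_mat A).2 _ _ pb'.
split=> //.
- split=> [a aal hia ar|z zn pz].
    by rewrite upd1E; case: (eqVneq a (que p)) => // _; exact: (aug_cov A).1.
  rewrite !upd1E; case: (eqVneq z b') pz => [-> pz|_ pz].
    by rewrite /perm pz in permb'.
  case: eqVneq pz => [-> pz|_ pz]; first by have := aug_perm A; rewrite /perm pz.
  exact: (aug_cov A).2.
- by rewrite num' (aug_num A).
- by rewrite upd1E eq_sym (negbTE qr) (aug_root A).
- by rewrite upd1E eqxx.
- by rewrite b'1.
- by have := aug_qt A; lia.
move=> q qp; have [|b2 [E h1 h2 h3]] := aug_path A (q := q); first by lia.
exists b2; split=> //; rewrite upd1E; case: (eqVneq (que q) (que p)) => // /(que_inj S) qq.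
by have := aug_qt A; lia.
Qed.

(** An undismissed vertex of A without a mate can only be the root, so the path ends there, and
    afterwards all of A - D is matched. *)
Lemma augmenting_last vis par que qt fnd b p mA' mB' :
  searching vis par que qt fnd -> augmenting par que qt b p mA' mB' ->
  mA' (que p) = 0 ->
  [/\ matching al be (upd1 mA' (que p) b.+1) (upd1 mB' b (que p).+1),
      covered al be n lo hi (upd1 mA' (que p) b.+1) (upd1 mB' b (que p).+1)
    & nmatched (upd1 mA' (que p) b.+1) = (nmatched mA).+1].
Proof.
move=> S A pb'; have aln : al <= n by lia.
have [qal hiq] := que_lt S (aug_qt A).
have qr : que p = r.
  apply/eqP/negPn/negP => qr.
  by have := (aug_cov A).1 _ qal hiq qr; rewrite pb'.
have [mat' num'] :=
  matching_add (aug_mat A) aln qal pb' (aug_free A) (aug_range A) (aug_adj A).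
split=> //; last by rewrite num' (aug_num A).
split=> [a aal hia _|z zn pz]; rewrite upd1E.
  by case: (eqVneq a (que p)) => // ap; apply: (aug_cov A).1 => //; rewrite -qr.
case: (eqVneq z b) pz => [-> pz|_ pz]; first by have := aug_perm A; rewrite /perm pz.
exact: (aug_cov A).2.
Qed.

End Search.

(** * Passing from one cut to the next *)

Definition cut_inv al be i lo hi mA mB :=
  [/\ labels al i lo hi, matching al be mA mB & covered al be n lo hi mA mB].

Lemma cut_inv0 lo hi mA mB :
  (forall j, j < n -> lo j = j - l) -> (forall j, j < n -> hi j = n) ->
  (forall j, mA j = 0) -> (forall j, mB j = 0) ->
  cut_inv 0 l 0 lo hi mA mB.
Proof.
move=> loE hiE mA0 mB0; split.
- split=> [a /hiE -> | b /loE -> | a b /hiE -> bn _]; [by left|by left|].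
  by rewrite loE //; lia.
- by split=> [a b|a b]; rewrite ?mA0 ?mB0.
split=> // b /andP[_ bn]; rewrite loE //; lia.
Qed.

(** From cut [i - 1] to cut [i], position [i + l] leaves B; being free, it takes no arc of the
    matching with it. *)
Lemma cut_inv_del0 i lo hi mA mB :
  cut_inv i (i + l) i lo hi mA mB -> mB (i + l) = 0 ->
  cut_inv i (i + l + 1) i.+1 lo hi mA mB.
Proof.
move=> [[h1 h2 h3] [h4 h5] [h6 h7]] b0; split.
- split=> // [a /h1|b /h2] [] => [|[*]|*|[*]]; try (by left); right; split=> //; lia.
- split=> // a b ab; have [? bb ? ?] := h5 _ _ ab; split=> //.
  move: bb; rewrite addn1 leq_eqVlt => /predU1P[E|//].
  by move/h4: ab; rewrite -E b0.
by split=> // b bn; apply: h7; lia.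
Qed.

(** When position [i + l] leaves B together with its arc, its mate [a] becomes the exempted vertex
    of [covered]. *)
Lemma cut_inv_del i lo hi mA mB a :
  cut_inv i (i + l) i lo hi mA mB -> i + l < n -> mB (i + l) = a.+1 ->
  [/\ labels i i.+1 lo hi,
      matching i (i + l + 1) (upd1 mA a 0) (upd1 mB (i + l) 0),
      covered i (i + l + 1) a lo hi (upd1 mA a 0) (upd1 mB (i + l) 0),
      a < i & (nmatched (upd1 mA a 0)).+1 = nmatched mA].
Proof.
move=> [[h1 h2 h3] mat [h6 h7]] iln ba; have iln' : i <= n by lia.
have [mat' ai _ num] := matching_del mat iln' ba.
split=> //; last 1 first.
- split=> [x xi hx xa|b bn pb]; rewrite upd1E.
    by rewrite (negbTE xa); apply: h6 => //; lia.
  by case: eqVneq => [|_]; [lia | apply: h7 => //; lia].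
- split=> // [x /h1|b /h2] [] => [|[*]|*|[*]]; try (by left); right; split=> //; lia.
by rewrite addn1.
Qed.

(** Position [i] enters A as the exempted vertex: matched vertices of A lie below [i], and only such
    vertices can have been dismissed. *)
Lemma cut_inv_add i lo hi mA mB :
  cut_inv i (i + l + 1) i.+1 lo hi mA mB -> i < n ->
  [/\ labels i.+1 i.+1 lo hi, matching i.+1 (i + l + 1) mA mB,
      covered i.+1 (i + l + 1) i lo hi mA mB, mA i = 0 & hi i = n].
Proof.
move=> [[h1 h2 h3] [h4 h5] [h6 h7]] iln; split.
- by split=> // a /h1[]; [left | move=> [*]; right; split=> //; lia].
- by split=> // a b /h5[*]; split=> //; lia.
- by split=> // a a1 ha ai; apply: h6 => //; lia.
- by case E: (mA i) => [//|b]; have [] := h5 _ _ E; lia.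
by case: (h1 _ iln) => // -[]; lia.
Qed.

(** [early] and [late] are the sizes of A - D and P at cut [i], read off the labels. Written as
    comparisons with [i], they keep their values when later cuts change the labels. *)
Definition early i (hi : nat -> nat) :=
  count (fun j => (j <= i) && (i < hi j)) (iota 0 n).
Definition late i (lo : nat -> nat) :=
  count (fun j => (i + l < j) && (lo j <= i)) (iota 0 n).

Lemma early_bound i lo hi mA mB :
  cut_inv i.+1 (i + l + 1) i.+1 lo hi mA mB -> early i hi <= nmatched mA.
Proof.
move=> [[h1 _ _] _ [h6 _]]; rewrite /early /nmatched -!size_filter.
apply: uniq_leq_size; first by rewrite filter_uniq ?iota_uniq.
move=> j; rewrite !mem_filter !mem_iota /= add0n => /andP[/andP[ji ih] jn].
rewrite jn andbT; apply: h6 => //; last by lia.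
by case: (h1 _ jn) => // -[]; lia.
Qed.

(** Essential vertices are counted through their mates, which are distinct. *)
Lemma late_bound i lo hi mA mB : i < n ->
  cut_inv i.+1 (i + l + 1) i.+1 lo hi mA mB -> late i lo <= nmatched mA.
Proof.
move=> iltn [[_ h2 _] [h4 h5] [_ h7]]; rewrite /late /nmatched -!size_filter.
set s := [seq j <- _ | _].
have sP j : j \in s -> exists a, [/\ mB j = a.+1, mA a = j.+1 & a < n].
  rewrite mem_filter mem_iota /= add0n => /andP[/andP[ji lj] jn].
  have [||a ja _] := h7 j; [by lia | by case: (h2 _ jn) => [|[]]; lia | ].
  by have aj := (h4 _ _).2 ja; exists a; split=> //; have [] := h5 _ _ aj; lia.
rewrite -(size_map (fun j => (mB j).-1)); apply: uniq_leq_size.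
  rewrite map_inj_in_uniq ?filter_uniq ?iota_uniq // => x y.
  move=> /sP[a [xa ax _]] /sP[b [yb bY _]]; rewrite xa yb /= => E.
  by move: ax; rewrite E bY => -[].
move=> _ /mapP[j /sP[a [ja aj an]] ->].
by rewrite ja mem_filter mem_iota /= aj.
Qed.

End Cuts.

(** * The program *)

Local Notation aRow := 2 (only parsing).
Local Notation aDeg := 3 (only parsing).
Local Notation aOrd := 4 (only parsing).
Local Notation vX := 5 (only parsing).
Local Notation vY := 6 (only parsing).
Local Notation vCount := 7 (only parsing).
Local Notation aMateA := 8 (only parsing).
Local Notation aMateB := 9 (only parsing).
Local Notation aLo := 10 (only parsing).
Local Notation aHi := 11 (only parsing).
Local Notation aVis := 12 (only parsing).
Local Notation aPar := 13 (only parsing).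
Local Notation aQue := 14 (only parsing).
Local Notation vHead := 15 (only parsing).
Local Notation vTail := 16 (only parsing).
Local Notation vFound := 17 (only parsing).
Local Notation vI := 18 (only parsing).
Local Notation vZ := 19 (only parsing).
Local Notation vB := 20 (only parsing).
Local Notation vP := 21 (only parsing).
Local Notation vRoot := 22 (only parsing).
Local Notation vSize := 23 (only parsing).
Local Notation vTangle := 24 (only parsing).
Local Notation vW := 25 (only parsing).

Definition eN : expr := Read 0 (Num 0).
Definition eK : expr := Read 0 (Num 1).
Definition eL : expr := Read 0 (Num 2).
Definition eSucc (e : expr) : expr := Add e (Num 1).
Definition eDiffer (e1 e2 : expr) : expr := Add (Sub e1 e2) (Sub e2 e1).
Definition incr (a : nat) : cmd := assign a (eSucc (var a)).

(** The machine cannot multiply, so the row offsets [u * n] of the adjacency matrix are tabulated by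
    additions. *)
Definition prepare : cmd :=
  For vX (Num 0) eN
    (Write aRow (eSucc (var vX)) (Add (Read aRow (var vX)) eN) ;;
     Write aLo (var vX) (Sub (var vX) eL) ;;
     Write aHi (var vX) eN).

Definition degrees : cmd :=
  For vX (Num 0) eN
    (For vY (Num 0) eN
      (Write aDeg (var vX)
        (Add (Read aDeg (var vX)) (Read 1 (Add (Read aRow (var vX)) (var vY)))))).

(** Every possible outdegree gets one pass over all vertices, which fits the quadratic budget. *)
Definition sorting : cmd :=
  For vX (Num 0) (eSucc eN)
    (For vY (Num 0) eN
      (If (eDiffer (Read aDeg (var vY)) (var vX)) Skip
        (Write aOrd (var vCount) (var vY) ;; incr vCount))).

(** [vTangle] holds the first position of the window plus one; 0 means that none was found. *)
Definition find_degree_tangle : cmd :=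
  For vX (Num 0) (Sub eN (eSucc eL))
    (If (Sub (Read aDeg (Read aOrd (Add (var vX) (eSucc eL))))
             (Add (Read aDeg (Read aOrd (var vX))) eK))
      Skip (assign vTangle (eSucc (var vX)))).

Definition output_degree_tangle : cmd :=
  Emit (Num 1) ;; Emit (eSucc (eSucc eL)) ;;
  For vX (Num 0) (eSucc (eSucc eL))
    (Emit (Read aOrd (Add (Sub (var vTangle) (Num 1)) (var vX)))).

Definition eBeta : expr := eSucc (Add (var vI) eL).
Definition eTop : expr := Read aQue (var vHead).
(** The end in A of the part of the augmenting path that is not yet flipped. *)
Definition eEnd : expr := Read aQue (var vP).

(** The queue is emptied even after a free vertex has been found; [vFound] keeps the last such
    vertex, plus one. Vertices are named by positions, and only the matrix is read through
    [aOrd]. *)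
Definition explore : cmd :=
  While (Sub (var vTail) (var vHead))
    (For vZ eBeta eN
      (If (Read aVis (var vZ)) Skip
        (If (Read 1 (Add (Read aRow (Read aOrd eTop)) (Read aOrd (var vZ))))
          (Write aVis (var vZ) (Num 1) ;;
           Write aPar (var vZ) (var vHead) ;;
           If (Read aMateB (var vZ))
             (Write aQue (var vTail) (Sub (Read aMateB (var vZ)) (Num 1)) ;;
              incr vTail)
             (assign vFound (eSucc (var vZ))))
          Skip)) ;;
     incr vHead).

Definition augment : cmd :=
  assign vB (Sub (var vFound) (Num 1)) ;;
  assign vP (Read aPar (var vB)) ;;
  While (Read aMateA eEnd)
    (assign vW (Sub (Read aMateA eEnd) (Num 1)) ;;
     Write aMateA eEnd (eSucc (var vB)) ;;
     Write aMateB (var vB) (eSucc eEnd) ;;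
     Write aMateB (var vW) (Num 0) ;;
     assign vB (var vW) ;;
     assign vP (Read aPar (var vB))) ;;
  Write aMateA eEnd (eSucc (var vB)) ;;
  Write aMateB (var vB) (eSucc eEnd) ;;
  incr vSize.

Definition dismiss : cmd :=
  For vZ (Num 0) (var vTail) (Write aHi (Read aQue (var vZ)) (var vI)) ;;
  For vZ eBeta eN
    (If (Read aVis (var vZ))
      (If (Sub (var vZ) (Add (Read aLo (var vZ)) eL)) Skip
        (Write aLo (var vZ) (var vI)))
      Skip).

(* z - (lo z + l) is nonzero exactly when z is essential, so that the search
   never enters the essential vertices. *)
Definition search : cmd :=
  For vZ (Num 0) eN
    (Write aVis (var vZ) (Sub (var vZ) (Add (Read aLo (var vZ)) eL))) ;;
  Write aQue (Num 0) (var vRoot) ;;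
  assign vHead (Num 0) ;;
  assign vTail (Num 1) ;;
  assign vFound (Num 0) ;;
  explore ;;
  If (var vFound) augment dismiss.

Definition eLeave : expr := Read aMateB (Add (var vI) eL).

(** [eLeave] is the stored mate of the position [i + l] that leaves B. A search from that mate is
    made only if it is undismissed, since vertices of D may stay unmatched. *)
Definition cut_step : cmd :=
  If eLeave
    (assign vRoot (Sub eLeave (Num 1)) ;;
     Write aMateB (Add (var vI) eL) (Num 0) ;;
     Write aMateA (var vRoot) (Num 0) ;;
     assign vSize (Sub (var vSize) (Num 1)) ;;
     If (Sub eN (Read aHi (var vRoot))) Skip search)
    Skip ;;
  assign vRoot (var vI) ;;
  search.

(** Once the matching has [k + 1] arcs the remaining rounds do nothing, so that it survives until
    the output. A cut raises the size by at most one, so [k + 1] is not exceeded. *)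
Definition cuts : cmd :=
  For vI (Num 0) (Sub eN (eSucc eL))
    (If (Sub (eSucc eK) (var vSize)) cut_step Skip).

Definition output_side (a : nat) : cmd :=
  Emit (eSucc eK) ;;
  For vX (Num 0) eN
    (If (Read a (var vX)) (Emit (Read aOrd (var vX))) Skip).

(** Nonzero exactly when position [vX] is not in bag [vI]. *)
Definition eOutside : expr :=
  Add (Sub (Read aLo (var vX)) (var vI)) (Sub (var vI) (Read aHi (var vX))).

(** Each bag is scanned twice because its cardinality precedes its elements on the tape. *)
Definition output_bags : cmd :=
  Emit (Num 3) ;;
  For vI (Num 0) (eSucc (Sub eN (eSucc eL)))
    (assign vCount (Num 0) ;;
     For vX (Num 0) eN (If eOutside Skip (incr vCount)) ;;
     Emit (var vCount) ;;
     For vX (Num 0) eN (If eOutside Skip (Emit (Read aOrd (var vX))))).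

Definition algorithm : cmd :=
  prepare ;; degrees ;; sorting ;; find_degree_tangle ;;
  If (var vTangle) output_degree_tangle
    (cuts ;;
     If (Sub (var vSize) eK)
       (Emit (Num 2) ;; output_side aMateA ;; output_side aMateB)
       output_bags).

(* Locked, since otherwise /= would unfold upto p y.+1. *)
Definition upto (p : pred nat) y := locked (filter p (iota 0 y)).

Lemma uptoE p y : upto p y = filter p (iota 0 y).
Proof. by rewrite /upto -lock. Qed.

Lemma upto0 p : upto p 0 = [::].
Proof. by rewrite uptoE. Qed.

Lemma uptoS p y : upto p y.+1 = upto p y ++ (if p y then [:: y] else [::]).
Proof. by rewrite !uptoE -addn1 iotaD filter_cat. Qed.

Lemma mem_upto p y v : (v \in upto p y) = (v < y) && p v.
Proof. by rewrite uptoE mem_filter mem_iota add0n andbC. Qed.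

Lemma upto_uniq p y : uniq (upto p y).
Proof. by rewrite uptoE filter_uniq ?iota_uniq. Qed.

(** * Correctness of the preprocessing and of the simpler outputs *)

Section Correctness.
Variables n k l : nat.

Definition params (s : state) :=
  [/\ mem s 0 0 = n, mem s 0 1 = k & mem s 0 2 = l].

Lemma params_frame c s s' : frame c s s' -> 0 \notin writes c -> params s -> params s'.
Proof. by move=> [fm _] c0; rewrite /params fm. Qed.

Lemma prepare_ok s : params s -> mem s aRow 0 = 0 ->
  run prepare s (fun s' t =>
    [/\ forall u, u <= n -> mem s' aRow u = u * n,
        forall j, j < n -> mem s' aLo j = j - l,
        forall j, j < n -> mem s' aHi j = n & t <= 100 * n.+1]).
Proof.
move=> P row0; apply: (run_for (h := n) (B := 50)
  (I := fun x s1 => [/\ forall u, u <= x -> mem s1 aRow u = u * n,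
        forall j, j < x -> mem s1 aLo j = j - l &
        forall j, j < x -> mem s1 aHi j = n])) => //.
- by move=> s1 /params_frame fr; have [? _ _] := fr isT P.
- by split=> // u; rewrite leqn0 => /eqP ->.
- move=> x s1 xn vx [rowE loE hiE] /params_frame fr; have [n1 k1 l1] := fr isT P.
  apply/run_seq/run_write/run_seq/run_write/run_write; rewrite /= /upd /= vx n1 l1.
  split=> //; split=> u; rewrite ?addn1 ?ltnS ?leqn0.
  + by case: (eqVneq u x.+1) => [->|*]; rewrite rowE; lia.
  + by case: (eqVneq u x) => [->//|*]; rewrite loE; lia.
  by case: (eqVneq u x) => [->//|*]; rewrite hiE; lia.
move=> s' t; rewrite max0n => -[rowE loE hiE] _ tB; split=> //.
by move: tB; rewrite /=; lia.
Qed.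

Lemma degrees_ok s (R : rel nat) : params s ->
  (forall u, u <= n -> mem s aRow u = u * n) ->
  (forall u, mem s aDeg u = 0) ->
  (forall u v, u < n -> v < n -> mem s 1 (u * n + v) = R u v) ->
  run degrees s (fun s' t =>
    (forall u, u < n -> mem s' aDeg u = size (upto (R u) n)) /\
    t <= 100 * n.+1 ^ 2).
Proof.
move=> P rowE deg0 RE; apply: (run_for (h := n) (B := 60 * n.+1)
  (I := fun x s1 => (forall u, u < x -> mem s1 aDeg u = size (upto (R u) n)) /\
    (forall u, x <= u -> mem s1 aDeg u = 0))) => //.
- by move=> s1 /params_frame fr; have [? _ _] := fr isT P.
- by split=> // u _; exact: deg0.
- move=> x s1 xn vx [degE degE0] fr0; have P1 := params_frame fr0 isT P.
  have [n1 _ _] := P1.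
  apply: (run_for (h := n) (B := 30) (I := fun y s2 => forall u, mem s2 aDeg u =
      if u == x then size (upto (R x) y) else mem s1 aDeg u)) => //.
  + by move=> s2 /params_frame fr; have [? _ _] := fr isT P1.
  + by move=> u /=; rewrite /upd /=; case: eqVneq => // ->; rewrite degE0 ?upto0.
  + move=> y s2 yn vy degE2 fr; apply/run_write; rewrite /= /upd /=.
    have -> : mem s2 vX 0 = x by rewrite fr.1.
    rewrite vy (fr.1 1) // (fr.1 aRow) // (fr0.1 1) // (fr0.1 aRow) // rowE ?RE; [|lia..].
    split=> // u; rewrite uptoS size_cat !degE2 eqxx.
    by case: eqVneq => // _; case: (R x y).
  move=> s' t; rewrite max0n => degE' fr' tB; split; last first.
    by move: tB => /=; lia.
  split=> u; rewrite /= /upd /= degE'; case: (eqVneq u x) => [->|ux]; try lia.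
    by move=> ?; apply: degE; lia.
  by move=> ?; apply: degE0; lia.
move=> s' t; rewrite max0n => -[degE _] _ tB; split=> //.
by move: tB => /=; rewrite -mulnn; nia.
Qed.

Definition bucket (deg : nat -> nat) m d := upto (fun v => deg v == d) m.
Definition sorted_by (deg : nat -> nat) x :=
  flatten [seq bucket deg n d | d <- iota 0 x].

Lemma sorted_byS deg x : sorted_by deg x.+1 = sorted_by deg x ++ bucket deg n x.
Proof. by rewrite /sorted_by -addn1 iotaD map_cat flatten_cat /= cats0. Qed.

Lemma mem_sorted_by deg x v : (v \in sorted_by deg x) = (v < n) && (deg v < x).
Proof.
elim: x => [|x IH]; first by rewrite andbF.
rewrite sorted_byS mem_cat IH mem_upto.
by case: (v < n) => //=; rewrite ltnS [in RHS]leq_eqVlt orbC.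
Qed.

Lemma sorted_by_perm deg x : (forall v, v < n -> deg v < x) ->
  perm_eq (sorted_by deg x) (iota 0 n).
Proof.
move=> degx; apply: uniq_perm; last 1 first.
- move=> v; rewrite mem_sorted_by mem_iota /= add0n.
  by case: ltnP => // /degx ->.
- elim: x {degx} => // x IH; rewrite sorted_byS cat_uniq IH upto_uniq // andbT.
  apply/hasPn => v; rewrite mem_upto => /andP[_ /eqP dv].
  by rewrite mem_sorted_by dv ltnn andbF.
exact: iota_uniq.
Qed.

Lemma sorted_by_pairwise deg x :
  pairwise (fun u v => deg u <= deg v) (sorted_by deg x).
Proof.
elim: x => // x IH; rewrite sorted_byS pairwise_cat IH /=; apply/andP; split.
  apply/allrelP => u v; rewrite mem_sorted_by mem_upto.
  by move=> /andP[_ /ltnW ux] /andP[_ /eqP ->].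
apply/(pairwiseP 0) => i j; rewrite !inE => ii jj _.
have := mem_nth 0 ii; have := mem_nth 0 jj; rewrite !mem_upto.
by move=> /andP[_ /eqP ->] /andP[_ /eqP ->].
Qed.

Lemma mkseq_push (f : nat -> nat) c x : mkseq (upd1 f c x) c.+1 = rcons (mkseq f c) x.
Proof.
rewrite mkseqS /upd1 eqxx; congr rcons; apply/eq_in_map => j.
by rewrite mem_iota => ?; case: eqVneq => //; lia.
Qed.

(** The filled prefix of [aOrd] is always the concatenation of the completed buckets and the current
    one. At the end it is a permutation of the vertices, which also shows that its length is [n]. *)
Lemma sorting_ok s deg : params s -> mem s vCount 0 = 0 ->
  (forall u, u < n -> mem s aDeg u = deg u) -> (forall u, u < n -> deg u <= n) ->
  run sorting s (fun s' t =>
    [/\ perm_eq (mkseq (mem s' aOrd) n) (iota 0 n),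
        forall i j, i <= j -> j < n -> deg (mem s' aOrd i) <= deg (mem s' aOrd j)
      & t <= 200 * n.+1 ^ 2]).
Proof.
move=> P c0 degE degn; apply: (run_for (h := n.+1) (B := 100 * n.+1)
  (I := fun x s1 => mkseq (mem s1 aOrd) (mem s1 vCount 0) = sorted_by deg x)) => //.
- by move=> s1 /params_frame fr; have [? _ _] := fr isT P; rewrite /= addn1; congr S.
- by rewrite /= /upd /= c0.
- move=> x s1 xn vx ordE fr0; have P1 := params_frame fr0 isT P.
  have [n1 _ _] := P1.
  apply: (run_for (h := n) (B := 50) (I := fun y s2 =>
    mkseq (mem s2 aOrd) (mem s2 vCount 0) = sorted_by deg x ++ bucket deg y x)) => //.
  + by move=> s2 /params_frame fr; have [? _ _] := fr isT P1.
  + by rewrite /= /upd /= /bucket upto0 cats0.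
  + move=> y s2 yn vy ordE2 fr.
    have vx2 : mem s2 vX 0 = x by rewrite fr.1.
    have dy : mem s2 aDeg y = deg y by rewrite fr.1 // fr0.1 // degE.
    apply: run_if => /= [dx|dx]; rewrite vy vx2 dy in dx.
      apply/run_skip; rewrite /= /upd /= ordE2 /bucket uptoS.
      have /negbTE -> : deg y != x by apply: contraNneq dx => ->; rewrite subnn.
      by rewrite cats0.
    apply/run_seq/run_write/run_write; rewrite /= /upd /= vy addn1 mkseq_push ordE2.
    have -> : bucket deg y.+1 x = rcons (bucket deg y x) y.
      by rewrite /bucket uptoS (_ : deg y == x) ?cats1 //; lia.
    by rewrite -rcons_cat.
  move=> s' t; rewrite max0n => ordE' fr' tB; split; last by move: tB => /=; lia.
  by rewrite /= /upd /= ordE' sorted_byS.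
move=> s' t; rewrite max0n => ordE _ tB.
have perm := @sorted_by_perm deg n.+1 degn; rewrite -ordE in perm.
have sz : mem s' vCount 0 = n by have := perm_size perm; rewrite size_mkseq size_iota.
rewrite sz in ordE perm; split=> //; last by move: tB => /=; rewrite -mulnn; nia.
move=> i j; rewrite leq_eqVlt => /predU1P[->//|ij] jn.
have := sorted_by_pairwise deg n.+1; rewrite -ordE => /(pairwiseP 0) /(_ i j).
by rewrite !inE size_mkseq !nth_mkseq //; [apply=> //; lia | lia].
Qed.

Lemma find_degree_tangle_ok s (deg : nat -> nat) : params s -> mem s vTangle 0 = 0 ->
  (forall x, x < n -> mem s aDeg (mem s aOrd x) = deg x) ->
  run find_degree_tangle s (fun s' t =>
    (if mem s' vTangle 0 is x.+1 then x + l.+1 < n /\ deg (x + l.+1) <= deg x + k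
     else forall x, x + l.+1 < n -> deg x + k < deg (x + l.+1)) /\
    t <= 200 * n.+1).
Proof.
move=> P t0 degE; apply: (run_for (h := n - l.+1) (B := 60)
  (I := fun y s1 => if mem s1 vTangle 0 is x.+1
     then x + l.+1 < n /\ deg (x + l.+1) <= deg x + k
     else forall x, x < y -> deg x + k < deg (x + l.+1))) => //.
- by move=> s1 /params_frame fr; have [? _ ?] := fr isT P; rewrite /= addn1; congr (_ - _.+1).
- by rewrite /= /upd /= t0.
- move=> y s1 yn vy IH fr; have [n1 k1 l1] := params_frame fr isT P.
  apply: run_if => /= [dx|dx]; rewrite vy l1 k1 addn1 !(fr.1 aDeg) // !(fr.1 aOrd) // !degE in dx; try lia.
    apply/run_skip; rewrite /= /upd /=; split=> //.
    case: (mem s1 vTangle 0) IH => // IH x; rewrite ltnS leq_eqVlt => /predU1P[->|/IH//].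
    lia.
  apply/run_write; rewrite /= /upd /= vy addn1; split=> //; lia.
move=> s' t; rewrite max0n => IH fr tB; split; last by move: tB => /=; lia.
by case: (mem s' vTangle 0) IH => // IH x xn; apply: IH; lia.
Qed.

Lemma emit_range_ok s x h :
  let c := For vX (Num 0) (eSucc (eSucc eL))
    (Emit (Read aOrd (Add (Sub (var vTangle) (Num 1)) (var vX)))) in
  params s -> mem s vTangle 0 = x.+1 -> h = l.+2 ->
  run c s (fun s' t => tape s' = tape s ++ [seq mem s aOrd (x + j) | j <- upto xpredT h] /\
    t <= 100 * h.+1).
Proof.
move=> c P tx ->; apply: (run_for (h := l.+2) (B := 20)
  (I := fun y s1 => tape s1 = tape s ++ [seq mem s aOrd (x + j) | j <- upto xpredT y])) => //.
- by move=> s1 /params_frame fr; have [_ _ ?] := fr isT P; rewrite /= !addn1; congr S; congr S.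
- by rewrite /= upto0 cats0.
- move=> y s1 _ vy tE fr; apply: run_emit; rewrite /= vy !fr.1 // tx subn1 /=; split=> //.
  by rewrite tE uptoS map_cat catA cats1.
by move=> s' t; rewrite max0n => tE fr tB; split=> //; move: tB => /=; lia.
Qed.

Lemma output_degree_tangle_ok s x : params s -> mem s vTangle 0 = x.+1 ->
  run output_degree_tangle s (fun s' t =>
    tape s' = tape s ++ [:: 1, l.+2 & [seq mem s aOrd (x + j) | j <- upto xpredT l.+2]] /\
    t <= 200 * l.+3).
Proof.
move=> P tx; have [n1 k1 l1] := P.
apply/run_seq/run_emit/run_seq/run_emit.
apply: (run_conseq (emit_range_ok (x := x) (h := l.+2) _ _ _)) => // s' t _ /= [-> tB].
by rewrite l1 !addn1 -!cats1 -!catA /=; split=> //; lia.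
Qed.

(** [[:: vX; vX]] is the value of [writes] on the loop. *)
Lemma emit_filter_ok s a (p : pred nat) : params s ->
  a \notin [:: vX; vX] ->
  (forall j, j < n -> mem s a j != 0 = p j) ->
  run (For vX (Num 0) eN (If (Read a (var vX)) (Emit (Read aOrd (var vX))) Skip)) s
    (fun s' t => tape s' = tape s ++ map (mem s aOrd) (upto p n) /\
      t <= 100 * n.+1).
Proof.
move=> P av aE; apply: (run_for (h := n) (B := 20)
  (I := fun y s1 => tape s1 = tape s ++ map (mem s aOrd) (upto p y))) => //.
- by move=> s1 /params_frame fr; have [? _ _] := fr isT P.
- by rewrite /= upto0 cats0.
- move=> y s1 yn vy tE fr; rewrite /=.
  have mE : forall b, b \notin [:: vX; vX] -> mem s1 b = mem s b by exact: fr.1.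
  apply: run_if => /=; rewrite vy mE // => ay.
    apply: run_emit; rewrite /= vy mE //; split=> //.
    by rewrite tE uptoS -aE ?ay ?map_cat ?catA ?cats1.
  apply: run_skip; rewrite /=; split=> //.
  by rewrite tE uptoS -aE ?ay ?cats0 //; lia.
by move=> s' t; rewrite max0n => tE fr tB; split=> //; move: tB => /=; lia.
Qed.
End Correctness.

(** * Correctness of the bag output and of the search *)

Section Cutting.
Variables n k l : nat.

Definition bag_list (ord lo hi : nat -> nat) i :=
  map ord (upto (fun j => lo j <= i <= hi j) n).

Lemma output_bags_ok s : params n k l s ->
  run output_bags s (fun s' t =>
    tape s' = tape s ++ 3 :: flatten [seq size b :: b |
      b <- map (bag_list (mem s aOrd) (mem s aLo) (mem s aHi)) (iota 0 (n - l.+1).+1)] /\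
    t <= 1000 * n.+1 ^ 2).
Proof.
move=> P; set bag := bag_list _ _ _.
apply/run_seq/run_emit; set s0 := State _ _.
have P0 : params n k l s0 by [].
apply: (run_for (h := (n - l.+1).+1) (B := 400 * n.+1)
  (I := fun y s1 => tape s1 = tape s0 ++
     flatten [seq size (bag j) :: bag j | j <- upto xpredT y])) => //.
- move=> s1 fr; have [? _ ?] := params_frame fr isT P0.
  by rewrite /= !addn1; congr ((_ - _.+1).+1).
- by rewrite /= upto0 cats0.
- move=> y s1 yn vy tE fr1; have P1 := params_frame fr1 isT P0.
  apply/run_seq/run_write/run_seq; set s2 := State _ _.
  have P2 : params n k l s2 by [].
  have outE s3 x : frame (For vX (Num 0) eN (If eOutside Skip (incr vCount))) s2 s3 ->
      mem s3 vX 0 = x -> (eval (mem s3) eOutside == 0) = (mem s aLo x <= y <= mem s aHi x).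
    move=> fr3 vx; rewrite /= vx (fr3.1 aLo) // (fr3.1 aHi) // (fr3.1 vI) // /= /upd /=.
    by rewrite vy (fr1.1 aLo) // (fr1.1 aHi) //= addn_eq0 !subn_eq0.
  apply: (run_for (h := n) (B := 40) (I := fun x s3 => mem s3 vCount 0 =
      size (upto (fun j => mem s aLo j <= y <= mem s aHi j) x))) => //.
  + by move=> s3 fr; have [? _ _] := params_frame fr isT P2.
  + by rewrite /= /upd /= upto0.
  + move=> x s3 xn vx cE fr3; have oE := outE _ _ fr3 vx.
    apply: run_if => [/negbTE|] e0; rewrite e0 ?eqxx in oE.
      by apply: run_skip; rewrite /= /upd /= uptoS -oE cats0.
    by apply: run_write; rewrite /= /upd /= uptoS -oE size_cat /= cE.
  move=> s3 t3; rewrite max0n => cE fr3 tB3.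
  apply/run_seq/run_emit; set s4 := State _ _.
  have P4 : params n k l s4 by exact: params_frame fr3 isT P2.
  have ordE : mem s4 aOrd = mem s aOrd.
    by rewrite /s4 /= (fr3.1 aOrd) // /s2 /= /upd /= (fr1.1 aOrd).
  have outE' s5 x : frame (For vX (Num 0) eN (If eOutside Skip (Emit (Read aOrd (var vX))))) s4 s5 ->
      mem s5 vX 0 = x -> (eval (mem s5) eOutside == 0) = (mem s aLo x <= y <= mem s aHi x).
    move=> fr5 vx; rewrite /= vx (fr5.1 aLo) // (fr5.1 aHi) // (fr5.1 vI) // /=.
    rewrite (fr3.1 aLo) // (fr3.1 aHi) // (fr3.1 vI) // /= /upd /=.
    by rewrite vy (fr1.1 aLo) // (fr1.1 aHi) //= addn_eq0 !subn_eq0.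
  apply: (run_for (h := n) (B := 40) (I := fun x s5 => tape s5 = tape s4 ++
     map (mem s aOrd) (upto (fun j => mem s aLo j <= y <= mem s aHi j) x))) => //.
  + by move=> s5 fr; have [? _ _] := params_frame fr isT P4.
  + by rewrite /= upto0 cats0.
  + move=> x s5 xn vx tE5 fr5; have oE := outE' _ _ fr5 vx.
    apply: run_if => [/negbTE|] e0; rewrite e0 ?eqxx in oE.
      by apply: run_skip; rewrite /= uptoS -oE cats0.
    by apply: run_emit; rewrite /= uptoS -oE map_cat catA tE5 cats1 vx (fr5.1 aOrd) // ordE.
  move=> s5 t5; rewrite max0n => tE5 fr5 tB5; split; last by move: tB3 tB5 => /=; lia.
  rewrite /= tE5 /s4 /= fr3.2 // /s2 /= cE tE uptoS map_cat flatten_cat /= cats0.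
  by rewrite /bag /bag_list size_map cat_rcons catA.
move=> s' t; rewrite max0n => tE fr tB; split.
  by rewrite tE /s0 [tape _]/= cat_rcons uptoE filter_predT -[in RHS]map_comp.
have : (n - l.+1).+1 <= n.+1 by lia.
by move: tB => /=; rewrite -mulnn; nia.
Qed.

Variable adj : rel nat.

(** [adj] relates positions while the matrix is indexed by vertices; [aOrd] and the row table
    translate. *)
Definition represents (s : state) := forall a b,
  adj a b = (mem s 1 (mem s aRow (mem s aOrd a) + mem s aOrd b) != 0).

Section Search.
Variables (i al r : nat) (lo hi mA mB : nat -> nat).
Hypothesis pre : search_pre n l adj i al r lo hi mA mB.

Definition searches (s : state) :=
  searching n l adj i al r lo hi mA mB (mem s aVis) (mem s aPar) (mem s aQue)
    (mem s vTail 0) (mem s vFound 0).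

Lemma explore_ok s : params n k l s -> represents s -> searches s ->
  mem s vHead 0 = 0 -> mem s vI 0 = i -> mem s aMateB = mB ->
  run explore s (fun s' t =>
    [/\ searches s',
        explored n l adj i (mem s' aQue) (mem s' aVis) (mem s' vTail 0) (i + l + 1)
      & t <= 400 * ((nmatched n mA).+2 * n.+1)]).
Proof.
move=> P rep S h0 iE mBE; have qb := queue_bound pre.
(* By [queue_bound] the head can advance at most [(nmatched n mA).+1] times, and each round scans B
   once. *)
apply: (run_while (I := fun s1 => [/\ searches s1, mem s1 vHead 0 <= mem s1 vTail 0
    & explored n l adj i (mem s1 aQue) (mem s1 aVis) (mem s1 vHead 0) (i + l + 1)])
  (mu := fun s1 => (nmatched n mA).+1 - mem s1 vHead 0) (B := 200 * n.+1)).
- split=> //; first by rewrite h0.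
  by rewrite h0 => p b _ bn; rewrite ltn0 /= => bi; move: bn; lia.
- move=> s1 [S1 ht ex1] fr1 /= ne; have {ne} ht1 : mem s1 vHead 0 < mem s1 vTail 0 by lia.
  have P1 := params_frame fr1 isT P; have [n1 _ l1] := P1.
  have i1 : mem s1 vI 0 = i by rewrite fr1.1.
  set h := mem s1 vHead 0 in ht ex1 ht1.
  apply/run_seq/(run_for (h := n) (B := 100) (I := fun z s2 =>
    [/\ searches s2, h < mem s2 vTail 0
      & explored n l adj i (mem s2 aQue) (mem s2 aVis) h z])) => //.
  + by move=> s2 fr; have [? _ _] := params_frame fr isT P1.
  + by rewrite /= i1 l1.
  + move=> z s2; rewrite /= i1 l1 => zn vz [S2 ht2 ex2] fr2.
    have hE : mem s2 vHead 0 = h by rewrite fr2.1.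
    have mB2 : mem s2 aMateB = mB by rewrite fr2.1 // fr1.1.
    apply: run_if => /= visz; rewrite vz in visz.
      apply: run_skip; split=> //; split; [exact: S2 | by [] |].
      exact: (explored_skip pre ex2 (or_introl visz)).
    have adjE : adj (mem s2 aQue h) z =
        (mem s2 1 (mem s2 aRow (mem s2 aOrd (mem s2 aQue h)) + mem s2 aOrd z) != 0).
      by rewrite rep (fr2.1 1) // (fr2.1 aRow) // (fr2.1 aOrd) // (fr1.1 1) // (fr1.1 aRow) // (fr1.1 aOrd).
    apply: run_if => /= adjz; rewrite vz hE in adjz; last first.
      apply: run_skip; split=> //; split; [exact: S2 | by [] |].
      by apply: (explored_skip pre ex2 (or_intror _)); rewrite adjE adjz.
    rewrite adjz in adjE.
    apply/run_seq/run_write/run_seq/run_write/run_if; rewrite /= /upd /= vz hE mB2 => mz.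
      apply/run_seq/run_write/run_write; rewrite /= /upd /= vz mB2 addn1.
      move: mz; case mBz: (mB z) => [//|a] _; rewrite subn1.
      split=> //; split.
      * exact: (searching_push pre S2 ht2 zn visz adjE mBz).
      * by rewrite (leq_trans ht2).
      exact: (explored_visit pre ex2 ht2).
    apply/run_write; rewrite /= /upd /= vz addn1; split=> //; split=> //.
      exact: (searching_free S2 ht2 zn visz adjE mz).
    (* Nothing is queued here, so [explored_visit] is used with a push that overwrites the entry at
       the tail by itself. *)
    have := explored_visit pre (a := mem s2 aQue (mem s2 vTail 0)) ex2 ht2.
    move=> exv p b pq bn bz ab; apply: (exv p b) => //.
    by rewrite upd1E; case: eqVneq ab => // ->.
  move=> s2 t2; rewrite /= i1 l1 => -[S2 ht2 ex2] fr2 tB.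
  have hE : mem s2 vHead 0 = h by rewrite fr2.1.
  apply: run_write; rewrite /= /upd /= hE addn1; split; last first.
  + have : n - (i + l + 1) <= n by lia.
    by move: tB; lia.
  + by have := qb _ _ _ _ _ S1; lia.
  split=> //; apply: (explored_next pre); move: ex2; rewrite (_ : maxn _ _ = n) //.
  by have := pre_be pre; lia.
move=> s' t [S' ht ex'] fr /= e0 tB; split=> //.
  by have -> : mem s' vTail 0 = mem s' vHead 0 by lia.
have : (nmatched n mA).+1 - mem s vHead 0 <= (nmatched n mA).+1 by lia.
by move: tB; nia.
Qed.

Lemma augment_ok s b : searches s -> mem s vFound 0 = b.+1 ->
  mem s aMateA = mA -> mem s aMateB = mB ->
  run augment s (fun s' t =>
    [/\ matching n adj al (i + l + 1) (mem s' aMateA) (mem s' aMateB),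
        covered n l al (i + l + 1) n lo hi (mem s' aMateA) (mem s' aMateB),
        nmatched n (mem s' aMateA) = (nmatched n mA).+1,
        mem s' vSize 0 = (mem s vSize 0).+1
      & t <= 100 * n.+2]).
Proof.
move=> S fE mAE mBE; rewrite /searches fE in S.
have A := augmenting_init pre S.
apply/run_seq/run_write/run_seq/run_write/run_seq => /=.
rewrite /upd /= fE subn1 /=; set s0 := State _ _.
(* The queue place [vP] decreases by [augmenting_step] and starts below the queue bound, so the walk
   takes O(n) rounds. *)
apply: (run_while (I := fun s1 => augmenting n l adj i al r lo hi mA
    (mem s aPar) (mem s aQue) (mem s vTail 0) (mem s1 vB 0) (mem s1 vP 0)
    (mem s1 aMateA) (mem s1 aMateB))
  (mu := fun s1 => mem s1 vP 0) (B := 60)).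
- by rewrite /s0 /= /upd /= mAE mBE.
- move=> s1 A1 fr1; have qE : mem s1 aQue = mem s aQue by rewrite fr1.1.
  have pE : mem s1 aPar = mem s aPar by rewrite fr1.1.
  rewrite /= qE; case mAq: (mem s1 aMateA _) => [//|b'] _.
  have [lt A2] := augmenting_step pre S A1 mAq.
  do 5 (apply/run_seq/run_write); apply/run_write.
  rewrite /= /upd /= qE pE mAq subn1 !addn1 /=; split=> //.
move=> s1 t1 A1 fr1 /=; have qE : mem s1 aQue = mem s aQue by rewrite fr1.1.
rewrite qE => mAq; have [mat' cov' num'] := augmenting_last pre S A1 mAq.
have sE : mem s1 vSize 0 = mem s vSize 0 by rewrite fr1.1.
move=> tB; do 2 (apply/run_seq/run_write); apply/run_write.
rewrite /= /upd /= qE sE (addn1 (mem s1 vB 0)) (addn1 (mem s aQue _)) (addn1 (mem s vSize 0)).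
split=> //; have := queue_bound pre S; have := aug_qt A; rewrite -mAE.
have : nmatched n (mem s aMateA) <= n.
  exact: nmatched_le.
by move: tB; rewrite /s0 /= /upd /=; lia.
Qed.

Lemma dismiss_ok s : params n k l s -> searches s -> mem s vFound 0 = 0 ->
  explored n l adj i (mem s aQue) (mem s aVis) (mem s vTail 0) (i + l + 1) ->
  mem s vI 0 = i -> mem s aLo = lo -> mem s aHi = hi -> nmatched n mA <= n ->
  run dismiss s (fun s' t =>
    [/\ labels n l adj al i.+1 (mem s' aLo) (mem s' aHi),
        covered n l al (i + l + 1) n (mem s' aLo) (mem s' aHi) mA mB,
        agree n i lo hi (mem s' aLo) (mem s' aHi)
      & t <= 200 * n.+2]).
Proof.
move=> P S fE ex iE loE hiE num; rewrite /searches fE in S.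
have qb := queue_bound pre S.
apply/run_seq/(run_for (h := mem s vTail 0) (B := 20) (I := fun z s1 => forall a,
  mem s1 aHi a = if a \in mkseq (mem s aQue) z then i else hi a)) => //.
- by move=> s1 fr; rewrite /= (fr.1 vTail).
- by move=> a; rewrite /= /upd /= hiE.
- move=> z s1 zn vz hE fr; apply: run_write; rewrite /= /upd /= vz (fr.1 aQue) // (fr.1 vI) // iE.
  split=> // a; rewrite hE mkseqS mem_rcons inE.
  by case: eqVneq.
move=> s1 t1; rewrite max0n => hE fr1 tB1.
have P1 := params_frame fr1 isT P; have [n1 _ l1] := P1.
have i1 : mem s1 vI 0 = i by rewrite fr1.1.
have lo1 : mem s1 aLo = lo by rewrite fr1.1.
apply: (run_for (h := n) (B := 40) (I := fun z s2 => forall b, mem s2 aLo b =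
  if [&& i + l + 1 <= b, b < z, mem s aVis b != 0 & ~~ (lo b + l < b)] then i else lo b)) => //.
- by move=> s2 fr; have [? _ _] := params_frame fr isT P1.
- move=> b; rewrite /= /upd /= lo1 i1 l1; case: ifP => //; lia.
- move=> z s2; rewrite /= i1 l1 => zn vz lE fr2; have [n2 _ l2] := params_frame fr2 isT P1.
  have step x : x = (if (mem s aVis z != 0) && ~~ (lo z + l < z) then i else lo z) ->
      forall b, (if b == z then x else mem s2 aLo b) =
      (if [&& i + l + 1 <= b, b < z.+1, mem s aVis b != 0 & ~~ (lo b + l < b)] then i else lo b).
    move=> -> b; rewrite lE ltnS; case: eqVneq => [->|bz]; first by rewrite (proj1 (andP zn)) leqnn.
    by rewrite [b <= z]leq_eqVlt (negbTE bz).
  have skip : mem s2 aLo z = (if (mem s aVis z != 0) && ~~ (lo z + l < z) then i else lo z) ->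
      forall b, mem s2 aLo b =
      (if [&& i + l + 1 <= b, b < z.+1, mem s aVis b != 0 & ~~ (lo b + l < b)] then i else lo b).
    by move=> h b; rewrite -(step _ h); case: eqVneq => [->|].
  have lz : mem s2 aLo z = lo z by rewrite lE ltnn /= andbF.
  have visE : mem s2 aVis = mem s aVis by rewrite fr2.1 // fr1.1.
  apply: run_if => /= vis; rewrite vz visE in vis; last first.
    by apply: run_skip; rewrite /= /upd /=; split=> //; apply: skip; rewrite lz vis.
  apply: run_if => /= lolt; rewrite vz lz l2 in lolt.
    apply: run_skip; rewrite /= /upd /=; split=> //; apply: skip; rewrite lz.
    by rewrite (_ : lo z + l < z) ?andbF //; lia.
  apply: run_write; rewrite /= /upd /= vz (fr2.1 vI) // i1; split=> //.
  by apply: step; rewrite vis (_ : lo z + l < z = false) //; lia.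
move=> s2 t2; rewrite /= i1 l1 => lE fr2 tB2.
have hE2 : mem s2 aHi = mem s1 aHi by rewrite fr2.1.
have [||h1 h2 h3] := search_fail pre S ex (lo' := mem s2 aLo) (hi' := mem s2 aHi).
- by move=> a _; rewrite hE2 hE.
- move=> b bn; rewrite lE (_ : b < maxn _ _) //; lia.
split=> //.
have : n - (i + l + 1) <= n by lia.
by move: tB1 tB2 => /=; lia.
Qed.

Lemma search_ok s : params n k l s -> represents s ->
  mem s vI 0 = i -> mem s vRoot 0 = r -> mem s aLo = lo -> mem s aHi = hi ->
  mem s aMateA = mA -> mem s aMateB = mB -> mem s vSize 0 = nmatched n mA ->
  run search s (fun s' t =>
    [/\ cut_inv n l adj al (i + l + 1) i.+1 (mem s' aLo) (mem s' aHi)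
          (mem s' aMateA) (mem s' aMateB),
        agree n i lo hi (mem s' aLo) (mem s' aHi),
        mem s' vSize 0 = nmatched n (mem s' aMateA),
        nmatched n (mem s' aMateA) <= (nmatched n mA).+1
      & t <= 1000 * ((nmatched n mA).+2 * n.+1)]).
Proof.
move=> P rep iE rE loE hiE mAE mBE sE.
have num := nmatched_le n mA.
apply/run_seq/(run_for (h := n) (B := 40) (I := fun z s1 => forall b, b < z ->
  mem s1 aVis b = b - (lo b + l))) => //.
- by move=> s1 fr; have [? _ _] := params_frame fr isT P.
- move=> z s1 zn vz vE fr1; have [n1 _ l1] := params_frame fr1 isT P.
  apply: run_write; rewrite /= /upd /= vz l1 (fr1.1 aLo) // loE; split=> //.
  move=> b; rewrite ltnS leq_eqVlt; case: eqVneq => [->//|_] /=; exact: vE.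
move=> s1 t1; rewrite max0n => vE fr1 tB1.
do 4 apply/run_seq/run_write.
rewrite /= /upd /=; set s2 := State _ _.
(* The list names what has been written so far: [vZ], [aVis], [vZ], [aQue], [vHead], [vTail],
   [vFound]. *)
have fr2 a : a \notin [:: 19; 12; 19; 14; 15; 16; 17] -> mem s2 a = mem s a.
  rewrite !inE !negb_or => /and5P[a1 a2 a3 a4 /and3P[a5 a6 a7]].
  rewrite /s2 /= (negbTE a4) (negbTE a5) (negbTE a6) (negbTE a7) /= fr1.1 //.
  by rewrite /= !inE !negb_or a1 a2.
have P2 : params n k l s2 by rewrite /params !fr2.
have rep2 : represents s2 by move=> a b; rewrite rep !fr2.
have S2 : searches s2.
  apply: (searching_init pre).
    by move=> b bn; rewrite /s2 /= vE.
  by rewrite /s2 /= (fr1.1 vRoot).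
apply/run_seq/(run_conseq (explore_ok P2 rep2 S2 _ _ _)).
- by [].
- by rewrite fr2.
- by rewrite fr2.
move=> s3 t3 fr3 [S3 ex3 tB3].
have P3 := params_frame fr3 isT P2.
have time1 : (n - 0) * (40 + (ecost eN + 10)) <= 60 * n by rewrite /=; lia.
apply: run_if => /= f0.
  move: f0; case fE: (mem s3 vFound 0) => [//|b] _.
  apply: (run_conseq (augment_ok S3 fE _ _)); [by rewrite fr3.1 // fr2..|].
  move=> s4 t4 fr4 [mat' cov' num' s' tB4].
  have lo4 : mem s4 aLo = lo by rewrite fr4.1 // fr3.1 // fr2.
  have hi4 : mem s4 aHi = hi by rewrite fr4.1 // fr3.1 // fr2.
  split; rewrite ?lo4 ?hi4 //; try by rewrite num'.
  - split=> //; exact: pre_lab pre.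
  - by rewrite s' num' fr3.1 // fr2 // sE.
  by move: tB1 tB3 tB4 => /=; nia.
apply: (run_conseq (dismiss_ok P3 S3 f0 ex3 _ _ _ num)); [by rewrite fr3.1 // fr2..|].
move=> s4 t4 fr4 [lab' cov' agr' tB4].
have mA4 : mem s4 aMateA = mA by rewrite fr4.1 // fr3.1 // fr2.
have mB4 : mem s4 aMateB = mB by rewrite fr4.1 // fr3.1 // fr2.
split; rewrite ?mA4 ?mB4 //.
- split=> //; exact: pre_mat pre.
- by rewrite fr4.1 // fr3.1 // fr2.
by move: tB1 tB3 tB4 => /=; nia.
Qed.

End Search.
End Cutting.

(** * The loop over the cuts and the sizes of the bags *)

Section Main.
Variables (n k l : nat) (adj : rel nat).

Lemma agree_trans i lo1 hi1 lo2 hi2 lo3 hi3 :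
  agree n i lo1 hi1 lo2 hi2 -> agree n i lo2 hi2 lo3 hi3 -> agree n i lo1 hi1 lo3 hi3.
Proof.
move=> [h1 l1] [h2 l2]; split=> i' a ii an; first by rewrite h2 // h1.
by rewrite l2 // l1.
Qed.

Lemma early_agree i i' lo hi lo' hi' : i' < i -> agree n i lo hi lo' hi' ->
  early n i' hi' = early n i' hi.
Proof.
move=> ii [h _]; apply: eq_in_count => j; rewrite mem_iota add0n => /= jn.
by rewrite h.
Qed.

Lemma late_agree i i' lo hi lo' hi' : i' < i -> agree n i lo hi lo' hi' ->
  late n l i' lo' = late n l i' lo.
Proof.
move=> ii [_ h]; apply: eq_in_count => j; rewrite mem_iota add0n => /= jn.
by rewrite h.
Qed.

Definition cut_state al be i (s : state) :=
  cut_inv n l adj al be i (mem s aLo) (mem s aHi) (mem s aMateA) (mem s aMateB) /\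
  mem s vSize 0 = nmatched n (mem s aMateA).

Lemma add_position_ok s i : params n k l s -> represents adj s -> mem s vI 0 = i ->
  i + l + 1 < n -> cut_state i (i + l + 1) i.+1 s ->
  run (assign vRoot (var vI) ;; search) s (fun s' t =>
    [/\ cut_state i.+1 (i + l + 1) i.+1 s',
        agree n i (mem s aLo) (mem s aHi) (mem s' aLo) (mem s' aHi),
        mem s' vSize 0 <= (mem s vSize 0).+1
      & t <= 1200 * ((mem s vSize 0).+2 * n.+1)]).
Proof.
move=> P rep iE iln [inv sE]; apply/run_seq/run_write; rewrite /= /upd /=.
have [|lab mat cov r0 hir] := cut_inv_add inv; first by lia.
have pre : search_pre n l adj i i.+1 i (mem s aLo) (mem s aHi) (mem s aMateA) (mem s aMateB).
  by split.
apply: (run_conseq (search_ok (k := k) pre _ _ _ _ _ _ _ _ _)) => // s' t fr.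
move=> [h1 h2 h3 h4 tB]; split=> //; first by rewrite h3 sE.
by rewrite sE; lia.
Qed.

Lemma cut_step_ok s i : params n k l s -> represents adj s -> mem s vI 0 = i ->
  i + l + 1 < n -> cut_state i (i + l) i s ->
  run cut_step s (fun s' t =>
    [/\ cut_state i.+1 (i + l + 1) i.+1 s',
        agree n i (mem s aLo) (mem s aHi) (mem s' aLo) (mem s' aHi),
        mem s' vSize 0 <= (mem s vSize 0).+1
      & t <= 3000 * ((mem s vSize 0).+2 * n.+1)]).
Proof.
move=> P rep iE iln [inv sE]; have [n0 k0 l0] := P; apply/run_seq.
(* Every branch of the first conditional is followed by the search from the new position [i], which
   is treated here once for all. *)
have next s1 t1 : frame cut_step s s1 -> cut_state i (i + l + 1) i.+1 s1 ->
    agree n i (mem s aLo) (mem s aHi) (mem s1 aLo) (mem s1 aHi) ->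
    mem s1 vSize 0 <= mem s vSize 0 -> t1 <= 1500 * ((mem s vSize 0).+2 * n.+1) ->
    run (assign vRoot (var vI) ;; search) s1 (fun s' t =>
      [/\ cut_state i.+1 (i + l + 1) i.+1 s',
        agree n i (mem s aLo) (mem s aHi) (mem s' aLo) (mem s' aHi),
        mem s' vSize 0 <= (mem s vSize 0).+1
      & t1 + t <= 3000 * ((mem s vSize 0).+2 * n.+1)]).
  move=> fr st agr size tB; have P1 := params_frame fr isT P.
  have rep1 : represents adj s1.
    by move=> a b; rewrite rep (fr.1 1) // (fr.1 aRow) // (fr.1 aOrd).
  have i1 : mem s1 vI 0 = i by rewrite fr.1.
  apply: (run_conseq (add_position_ok P1 rep1 i1 iln st)) => s' t _ [h1 h2 h3 h4].
  split=> //; [exact: agree_trans agr h2 | by lia | ].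
  have : (mem s1 vSize 0).+2 * n.+1 <= (mem s vSize 0).+2 * n.+1.
    by rewrite leq_mul2r; lia.
  by lia.
suff: run (If eLeave
    (assign vRoot (Sub eLeave (Num 1)) ;;
     Write aMateB (Add (var vI) eL) (Num 0) ;;
     Write aMateA (var vRoot) (Num 0) ;;
     assign vSize (Sub (var vSize) (Num 1)) ;;
     If (Sub eN (Read aHi (var vRoot))) Skip search)
    Skip) s (fun s1 t1 => [/\ cut_state i (i + l + 1) i.+1 s1,
      agree n i (mem s aLo) (mem s aHi) (mem s1 aLo) (mem s1 aHi),
      mem s1 vSize 0 <= mem s vSize 0 & t1 <= 1500 * ((mem s vSize 0).+2 * n.+1)]).
  move=> h; apply: (run_conseq h) => s1 t1 fr [h1 h2 h3 h4]; apply: next => //.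
  exact: frame_seql.
apply: run_if => /=; rewrite iE l0 => m0; last first.
  apply: run_skip; split=> //; last by lia.
  by split=> //; exact: cut_inv_del0.
move: m0; case mB: (mem s aMateB (i + l)) => [//|a] _.
do 4 apply/run_seq/run_write; rewrite /= /upd /= iE l0 mB !subn1 /=.
have [|lab mat cov ai num] := cut_inv_del inv _ mB; first by lia.
apply: run_if; rewrite /= n0 => hia.
  (* Here [a] was dismissed earlier, so A - D is still covered although [a] has lost its mate. *)
  apply: run_skip; split=> //=; [|by lia..].
  split; last by rewrite /= sE -num.
  split=> //; split; last exact: cov.2.
  move=> x xi hx _; apply: cov.1 => //; apply: contra_neq hia => xa.
  by have hx' : mem s aHi x = n := hx; rewrite -xa hx' subnn.
have hin : mem s aHi a = n.
  by have [hiP _ _] := lab; case: (hiP a _) => [|//|[]]; lia.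
have pre : search_pre n l adj i i a (mem s aLo) (mem s aHi)
    (upd1 (mem s aMateA) a 0) (upd1 (mem s aMateB) (i + l) 0).
  by split=> //; rewrite upd1E eqxx.
apply: (run_conseq (search_ok (k := k) pre _ _ _ _ _ _ _ _ _)) => //.
  by rewrite /= sE -num.
move=> s' t fr [h1 h2 h3 h4 tB]; split=> //; first by rewrite h3 sE; lia.
rewrite sE -num; have : (nmatched n (upd1 (mem s aMateA) a 0)).+2 * n.+1 <=
    (nmatched n (upd1 (mem s aMateA) a 0)).+3 * n.+1 by rewrite leq_mul2r; lia.
by lia.
Qed.

Lemma cuts_ok s : params n k l s -> represents adj s -> cut_state 0 l 0 s ->
  mem s vSize 0 = 0 ->
  run cuts s (fun s' t =>
    [/\ mem s' vSize 0 = nmatched n (mem s' aMateA),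
        (mem s' vSize 0 <= k /\
         [/\ labels n l adj (n - l.+1) (n - l.+1) (mem s' aLo) (mem s' aHi),
             forall i, i < n - l.+1 -> early n i (mem s' aHi) <= k
           & forall i, i < n - l.+1 -> late n l i (mem s' aLo) <= k]) \/
        (mem s' vSize 0 = k.+1 /\ exists2 i, i + l + 1 < n &
           matching n adj i.+1 (i + l + 1) (mem s' aMateA) (mem s' aMateB))
      & t <= 5000 * (k.+2 * n.+1 ^ 2)]).
Proof.
move=> P rep st s0.
(* Either all cuts so far have covers of size at most [k] and the cut invariant holds, or a matching
   of [k + 1] arcs across some cut has been frozen. *)
apply: (run_for (h := n - l.+1) (B := 4000 * (k.+2 * n.+1)) (I := fun i s1 =>
    mem s1 vSize 0 = nmatched n (mem s1 aMateA) /\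
        ((mem s1 vSize 0 <= k /\
         [/\ cut_state i (i + l) i s1,
             forall i', i' < i -> early n i' (mem s1 aHi) <= k
           & forall i', i' < i -> late n l i' (mem s1 aLo) <= k]) \/
        (mem s1 vSize 0 = k.+1 /\ exists2 i, i + l + 1 < n &
           matching n adj i.+1 (i + l + 1) (mem s1 aMateA) (mem s1 aMateB))))) => //.
- by move=> s1 fr; have [? _ ?] := params_frame fr isT P; rewrite /= addn1; congr (_ - _.+1).
- split; first exact: st.2.
  by left; rewrite /= /upd /= s0; split=> //; split.
- move=> i s1 /= iln vi [sE inv] fr; have P1 := params_frame fr isT P.
  have [n1 k1 l1] := P1.
  have rep1 : represents adj s1.
    by move=> a b; rewrite rep (fr.1 1) // (fr.1 aRow) // (fr.1 aOrd).
  apply: run_if; rewrite /= k1 addn1 => sk; last first.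
    apply: run_skip; rewrite /= /upd /=; split; last by nia.
    by split=> //; case: inv => [[h _]|h]; [lia | right].
  case: inv => [[sk' [st1 ear lat]]|[? _]]; last by lia.
  have il : i + l + 1 < n by lia.
  apply: (run_conseq (cut_step_ok P1 rep1 vi il st1)) => s2 t2 fr2 [st2 agr size tB].
  rewrite /= /upd /=; split; last first.
    have : (mem s1 vSize 0).+2 * n.+1 <= k.+2 * n.+1 by rewrite leq_mul2r; lia.
    by nia.
  split; first exact: st2.2.
  case: (leqP (mem s2 vSize 0) k) => sk2; last first.
    right; split; first by lia.
    by exists i => //; have [[]] := st2.
  have i1l : i.+1 + l = i + l + 1 by lia.
  left; split=> //; rewrite i1l; split=> // i'; rewrite ltnS leq_eqVlt => /predU1P[->|ii].
  + by apply: leq_trans (early_bound st2.1) _; rewrite -st2.2.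
  + by rewrite (early_agree ii agr); apply: ear.
  + by apply: leq_trans (late_bound _ st2.1) _; [lia | rewrite -st2.2].
  by rewrite (late_agree ii agr); apply: lat.
move=> s' t; rewrite max0n => -[sE inv] fr tB; split=> //.
  by case: inv => [[h1 [[[h2 _ _] _] h3 h4]]|]; [left | right].
have : (n - l.+1) * (4000 * (k.+2 * n.+1) + 16) <= n.+1 * (4000 * (k.+2 * n.+1) + 16).
  by rewrite leq_mul2r; lia.
by move: tB => /=; rewrite -mulnn; nia.
Qed.

Lemma count_split (p p1 p2 : pred nat) s :
  (forall j, j \in s -> p j -> p1 j || p2 j) -> count p s <= count p1 s + count p2 s.
Proof.
elim: s => //= x s IH h.
have {}IH : count p s <= count p1 s + count p2 s.
  by apply: IH => j js; apply: h; rewrite inE js orbT.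
have := h x; rewrite inE eqxx => /(_ isT).
case: (p x) => [/(_ isT)|_]; last by lia.
by case: (p1 x) => /= [_|->]; lia.
Qed.

Lemma count_window i : count (fun j => i <= j <= i + l) (iota 0 n) <= l.+1.
Proof.
rewrite -size_filter -[leqRHS](size_iota i); apply: uniq_leq_size.
  by rewrite filter_uniq ?iota_uniq.
by move=> j; rewrite mem_filter !mem_iota; lia.
Qed.

(** Bag [i] consists of the window from [i] to [i + l], the part in A of the cover of cut [i - 1],
    and the part in B of the cover of cut [i]: at most [l + 1 + k + k] positions. The first bag has
    no preceding cut, and the last one no position beyond its window. *)
Lemma bag_size lo hi i : i <= n - l.+1 ->
  (forall i, i < n - l.+1 -> early n i hi <= k) ->
  (forall i, i < n - l.+1 -> late n l i lo <= k) ->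
  count (fun j => lo j <= i <= hi j) (iota 0 n) <= (l + 2 * k).+1.
Proof.
move=> ic ear lat; have win := count_window i.
have late_i : count (fun j => (i + l < j) && (lo j <= i)) (iota 0 n) <= k.
  case: (ltnP i (n - l.+1)) => [/lat//|ci]; rewrite (@eq_in_count _ _ pred0) ?count_pred0 //.
  by move=> j; rewrite mem_iota /=; lia.
have early_i : count (fun j => (j < i) && (i <= hi j)) (iota 0 n) <= k.
  case: i ic {win late_i} => [|i] ic; last exact: ear.
  by rewrite (@eq_in_count _ _ pred0) ?count_pred0.
pose q j := (i <= j <= i + l) || ((i + l < j) && (lo j <= i)).
have h1 : count (fun j => lo j <= i <= hi j) (iota 0 n) <=
    count (fun j => (j < i) && (i <= hi j)) (iota 0 n) + count q (iota 0 n).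
  by apply: count_split => j _; rewrite /q; lia.
have h2 : count q (iota 0 n) <= count (fun j => i <= j <= i + l) (iota 0 n) +
    count (fun j => (i + l < j) && (lo j <= i)) (iota 0 n).
  exact: count_split.
by lia.
Qed.

End Main.

(** * From positions back to the digraph *)

Section Outcomes.
Variables (n k l : nat) (T : rel 'I_n).
Variables (R : rel nat) (ord : nat -> nat).
Hypothesis RT : forall u v : 'I_n, R u v = T u v.
Hypothesis ordP : perm_eq (mkseq ord n) (iota 0 n).

Definition seq_set (s : seq nat) : {set 'I_n} := [set x | val x \in s].

Lemma seq_set_lists s : uniq s -> (forall x, x \in s -> x < n) -> lists s (seq_set s).
Proof.
move=> us sn; apply: uniq_perm => //.
  by rewrite map_inj_uniq ?enum_uniq //; exact: val_inj.
move=> x; apply/idP/mapP => [xs|[y + ->]]; last by rewrite mem_enum inE.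
by exists (Ordinal (sn _ xs)) => //; rewrite mem_enum inE.
Qed.

Lemma lists_card s (X : {set 'I_n}) : lists s X -> size s = #|X|.
Proof. by move/perm_size; rewrite size_map -cardE. Qed.

Lemma ord_lt j : j < n -> ord j < n.
Proof.
move=> jn; have : ord j \in iota 0 n.
  by rewrite -(perm_mem ordP); apply: map_f; rewrite mem_iota.
by rewrite mem_iota.
Qed.

Lemma ord_inj i j : i < n -> j < n -> ord i = ord j -> i = j.
Proof.
move=> iN jN E; have := perm_uniq ordP; rewrite iota_uniq => us.
have := nth_uniq 0 _ _ us; rewrite size_mkseq => /(_ i j iN jN).
by rewrite !nth_mkseq // E eqxx => /esym/eqP.
Qed.

Lemma ord_onto (x : 'I_n) : exists2 j, j < n & val x = ord j.
Proof.
have : val x \in mkseq ord n by rewrite (perm_mem ordP) mem_iota /=.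
by case/mapP => j; rewrite mem_iota => /= jn ->; exists j.
Qed.

Lemma mem_ord_upto p j : j < n -> (ord j \in map ord (upto p n)) = p j.
Proof.
move=> jn; apply/mapP/idP => [[i]|pj]; last by exists j; rewrite ?mem_upto ?jn.
by rewrite mem_upto => /andP[iN pi] /(ord_inj jn iN) ->.
Qed.

Lemma lists_ord_upto p : lists (map ord (upto p n)) (seq_set (map ord (upto p n))).
Proof.
apply: seq_set_lists.
  rewrite map_inj_in_uniq ?upto_uniq // => i j; rewrite !mem_upto.
  by move=> /andP[iN _] /andP[jN _]; exact: ord_inj.
by move=> x /mapP[j + ->]; rewrite mem_upto => /andP[jn _]; exact: ord_lt.
Qed.

Lemma card_ord_upto p : #|seq_set (map ord (upto p n))| = count p (iota 0 n).
Proof. by rewrite -(lists_card (lists_ord_upto p)) size_map uptoE size_filter. Qed.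

Lemma outdegreeE (u : 'I_n) : outdegree T u = size (upto (R u) n).
Proof.
rewrite /outdegree uptoE -val_enum_ord filter_map size_map cardE.
apply/perm_size/uniq_perm => [||v]; first exact: enum_uniq.
  by apply: filter_uniq; exact: enum_uniq.
by rewrite mem_enum inE mem_filter mem_enum /= RT andbT.
Qed.

Section DegreeTangle.
Variable x : nat.
Hypothesis xn : x + l.+1 < n.
Let window := [seq ord (x + j) | j <- upto xpredT l.+2].

Lemma lists_window : lists window (seq_set window).
Proof.
apply: seq_set_lists.
  rewrite map_inj_in_uniq ?upto_uniq // => i j; rewrite !mem_upto !andbT => iN jN E.
  by suff: x + i = x + j; [lia | apply: ord_inj E; lia].
move=> y /mapP[j + ->]; rewrite mem_upto => /andP[jl _]; apply: ord_lt; lia.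
Qed.

Hypothesis degE : forall i j, i <= j -> j < n ->
  size (upto (R (ord i)) n) <= size (upto (R (ord j)) n).
Hypothesis deg_gap :
  size (upto (R (ord (x + l.+1))) n) <= size (upto (R (ord x)) n) + k.

(** By monotonicity the outdegrees in the window lie between those of its two ends. *)
Lemma window_tangle : degree_tangle T (l + 2) k (seq_set window).
Proof.
split.
  rewrite -(lists_card lists_window) size_map uptoE filter_predT size_iota; lia.
have bounds (v : 'I_n) : v \in seq_set window ->
    size (upto (R (ord x)) n) <= outdegree T v <= size (upto (R (ord x)) n) + k.
  rewrite inE outdegreeE => /mapP[j + ->]; rewrite mem_upto andbT => jl.
  rewrite degE ?leq_addr //=; last by lia.
  by apply: leq_trans deg_gap; apply: degE; lia.
by move=> v w /bounds hv /bounds hw; move: hv hw; lia.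
Qed.
End DegreeTangle.

Definition position_adj (a b : nat) := R (ord a) (ord b).

(** Matched vertices of A have positions up to [i], their mates positions from [i + l + 1] on, so
    the sorted order and the gap separate the outdegrees by more than [k]. *)
Lemma matching_tangle_of mA mB i : i + l + 1 < n ->
  (forall i j, i <= j -> j < n ->
    size (upto (R (ord i)) n) <= size (upto (R (ord j)) n)) ->
  size (upto (R (ord i)) n) + k < size (upto (R (ord (i + l + 1))) n) ->
  matching n position_adj i.+1 (i + l + 1) mA mB -> nmatched n mA = k.+1 ->
  matching_tangle T k.+1 k
    (seq_set (map ord (upto (fun a => mA a != 0) n)))
    (seq_set (map ord (upto (fun b => mB b != 0) n))).
Proof.
move=> iln degE gap [mm mr] num; set X := seq_set _; set Y := seq_set _.
have XP (v : 'I_n) : v \in X -> exists a b, [/\ a < n, val v = ord a & mA a = b.+1].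
  rewrite inE => /mapP[a]; rewrite mem_upto => /andP[an ma] ->.
  by case E: (mA a) ma => [//|b] _; exists a, b.
have YP (v : 'I_n) : v \in Y -> exists a b, [/\ b < n, val v = ord b & mB b = a.+1].
  rewrite inE => /mapP[b]; rewrite mem_upto => /andP[bn mb] ->.
  by case E: (mB b) mb => [//|a] _; exists a, b.
(* [index] inverts [ord], and the predecessor decodes the stored mate. *)
pose f (v : 'I_n) : 'I_n := insubd v (ord (mA (index (val v) (mkseq ord n))).-1).
have fE (v : 'I_n) a b : a < n -> val v = ord a -> mA a = b.+1 -> val (f v) = ord b.
  move=> an va ab; have [_ _ bn _] := mr _ _ ab.
  have -> : f v = insubd v (ord b).
    rewrite /f va -(nth_mkseq 0 ord an) index_uniq ?size_mkseq ?ab //.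
    by rewrite (perm_uniq ordP) iota_uniq.
  by rewrite val_insubd ord_lt.
have injf : {in X &, injective f}.
  move=> v w /XP[a [b [an va ab]]] /XP[a' [b' [an' wa ab']]] E.
  have := fE _ _ _ an va ab; rewrite E (fE _ _ _ an' wa ab') => /ord_inj bb.
  have [_ _ bn _] := mr _ _ ab; have [_ _ bn' _] := mr _ _ ab'.
  move: ab ab'; rewrite (bb bn' bn) => /mm ba /mm; rewrite ba => -[aa].
  by apply: val_inj; rewrite /= va wa aa.
have fXY : f @: X = Y.
  apply/setP => w; apply/imsetP/idP => [[v /XP[a [b [an va ab]]] ->]|/YP[a [b [bn wb ba]]]].
    have [_ _ bn _] := mr _ _ ab.
    by rewrite inE (fE _ _ _ an va ab) mem_ord_upto // (mm a b).1.
  have ab := (mm _ _).2 ba; have [ai _ _ _] := mr _ _ ab.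
  have an : a < n by lia.
  exists (Ordinal (ord_lt an)); first by rewrite inE /= mem_ord_upto // ab.
  by apply: val_inj; rewrite (fE _ a b) //= wb.
have cX : #|X| = k.+1 by rewrite card_ord_upto.
have low (v : 'I_n) : v \in X -> outdegree T v <= size (upto (R (ord i)) n).
  move=> /XP[a [b [an va ab]]]; have [ai _ _ _] := mr _ _ ab.
  by rewrite outdegreeE va degE //; lia.
have high (w : 'I_n) : w \in Y -> size (upto (R (ord (i + l + 1))) n) <= outdegree T w.
  move=> /YP[a [b [bn wb /mm ab]]]; have [_ bi _ _] := mr _ _ ab.
  by rewrite outdegreeE wb degE.
split=> //.
- apply/pred0P => v; apply/negP => /andP[vX vY].
  by have := low _ vX; have := high _ vY; lia.
- by rewrite -fXY card_in_imset.
- exists f; split=> // v /XP[a [b [an va ab]]]; rewrite -RT va (fE _ _ _ an va ab).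
  by have [] := mr _ _ ab.
by move=> v w /low lv /high hw; lia.
Qed.

Section Bags.
Variables lo hi : nat -> nat.
Let c := n - l.+1.
Hypothesis lab : labels n l position_adj c c lo hi.
Hypothesis ear : forall i, i < c -> early n i hi <= k.
Hypothesis lat : forall i, i < c -> late n l i lo <= k.

Let bag i := bag_list n ord lo hi i.
Let bags := [seq seq_set (bag i) | i <- iota 0 c.+1].

Lemma nth_bags i : i < c.+1 -> nth set0 bags i = seq_set (bag i).
Proof. by move=> ic; rewrite (nth_map 0) ?size_iota // nth_iota. Qed.

Lemma size_bags : size bags = c.+1.
Proof. by rewrite size_map size_iota. Qed.

Lemma mem_bag i (v : 'I_n) j : j < n -> val v = ord j ->
  (v \in seq_set (bag i)) = (lo j <= i <= hi j).
Proof. by move=> jn vj; rewrite inE vj mem_ord_upto. Qed.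

Lemma label_bounds j : j < n -> lo j <= j - l /\ j <= hi j.
Proof.
move=> jn; have [h1 h2 _] := lab.
by case: (h1 _ jn) (h2 _ jn) => [->|[_ ? _]] [->|[]]; lia.
Qed.

Lemma bags_path_decomposition : path_decomposition T bags.
Proof.
split.
- apply/setP => v; rewrite inE; have [j jn vj] := ord_onto v.
  have [lj hj] := label_bounds jn.
  (* Position [j] lies in bag [j], or in the last bag [c] if [j] exceeds [c]. *)
  have ic : minn j c < c.+1 by lia.
  rewrite (big_nth set0) big_mkord; apply/bigcupP.
  have ib : minn j c < size bags by rewrite size_bags.
  by exists (Ordinal ib) => //=; rewrite nth_bags // (mem_bag _ jn vj) /c; lia.
- move=> i j m ij jm; rewrite size_bags => mc; rewrite !nth_bags; [|lia..].
  apply/subsetP => v; have [x xn vx] := ord_onto v.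
  by rewrite in_setI !(mem_bag _ xn vx); lia.
move=> u v Tuv; have [a an ua] := ord_onto u; have [b bn vb] := ord_onto v.
have [_ _ arcs] := lab.
have ab : lo b <= hi a by apply: arcs => //; rewrite /position_adj -ua -vb RT.
have [la ha] := label_bounds an; have [lb hb] := label_bounds bn.
(* The tail is last seen in bag [hi a], capped at the last index [c], and the head first in bag
   [lo b]; the arc inequality gives a common bag or puts the tail later. *)
have ua' : u \in nth set0 bags (minn (hi a) c).
  by rewrite nth_bags ?(mem_bag _ an ua) /c; lia.
have vb' : v \in nth set0 bags (lo b).
  by rewrite nth_bags ?(mem_bag _ bn vb) /c; lia.
have le : lo b <= minn (hi a) c by rewrite /c; lia.
have sz : minn (hi a) c < size bags by rewrite size_bags; lia.
move: le; rewrite leq_eqVlt => /predU1P[E|lt].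
  by left; exists (minn (hi a) c); split=> //; rewrite -E.
by right; exists (minn (hi a) c), (lo b).
Qed.

Lemma bags_width : width bags <= l + 2 * k.
Proof.
rewrite /width; apply/bigmax_leqP_seq => W /mapP[i + ->] _.
rewrite mem_iota add0n ltnS => /= ic; rewrite -ltnS.
have size_i := bag_size ic ear lat.
have cardE : #|seq_set (bag i)| = count (fun j => lo j <= i <= hi j) (iota 0 n).
  exact: card_ord_upto.
by rewrite cardE; lia.
Qed.

Lemma lists_bags (r : seq nat) :
  all2 (@lists n) [seq bag i | i <- r] [seq seq_set (bag i) | i <- r].
Proof. by elim: r => //= i r ->; rewrite lists_ord_upto. Qed.
End Bags.

End Outcomes.

(** * The whole algorithm *)

Lemma input_adj n (T : rel 'I_n) k l (u v : 'I_n) :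
  mem (input T k l) 1 (u * n + v) = T u v.
Proof.
rewrite /=; congr nat_of_bool; apply/existsP/idP => [[u' /existsP[v' /andP[/eqP E Tuv]]]|Tuv].
  have n0 : 0 < n by have := ltn_ord u; lia.
  (* Columns are below [n], so division with remainder recovers row and column. *)
  have := congr1 (fun x => x %/ n) E; have := congr1 (fun x => x %% n) E.
  rewrite !modnMDl !divnMDl // !divn_small // !modn_small // !addn0.
  by move=> /val_inj -> /val_inj ->.
by exists u; apply/existsP; exists v; rewrite eqxx.
Qed.

(** Replacing [k.+2] and [n.+1] by the two maxima costs a factor [3 * 2 ^ 2 = 12], and
    [12 * 70 = 840]. *)
Lemma budget n k t : t <= 70 * 100 * (k.+2 * n.+1 ^ 2) ->
  t <= 840 * 100 * (maxn 1 k * maxn 1 n ^ 2).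
Proof.
have hk : k.+2 <= 3 * maxn 1 k by lia.
have hn : n.+1 <= 2 * maxn 1 n by lia.
have : k.+2 * n.+1 ^ 2 <= 12 * (maxn 1 k * maxn 1 n ^ 2).
  rewrite -!mulnn; apply: leq_trans (leq_mul hk (leq_mul hn hn)) _.
  by rewrite (mulnACA 2) -/4 mulnACA.
by set x := k.+2 * _; set y := maxn 1 k * _; lia.
Qed.

Lemma output_sides_ok n k l s : params n k l s ->
  run (output_side aMateA ;; output_side aMateB) s (fun s' t =>
    tape s' = tape s ++
      (k.+1 :: map (mem s aOrd) (upto (fun a => mem s aMateA a != 0) n)) ++
      (k.+1 :: map (mem s aOrd) (upto (fun b => mem s aMateB b != 0) n)) /\
    t <= 300 * n.+1).
Proof.
move=> P; have [n0 k0 l0] := P.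
apply/run_seq/run_seq/run_emit; set s1 := State _ _.
apply: (run_conseq (emit_filter_ok (s := s1) (k := k) (l := l) P (a := aMateA)
  (p := fun a => mem s aMateA a != 0) _ _)) => // s2 t2 fr2 [tE2 tB2].
apply/run_seq/run_emit; set s3 := State _ _.
have P3 : params n k l s3 by exact: params_frame fr2 isT P.
have mE a : a \notin [:: vX; vX] -> mem s3 a = mem s a.
  by move=> av; rewrite /s3 /= fr2.1.
apply: (run_conseq (emit_filter_ok (s := s3) (k := k) (l := l) P3 (a := aMateB)
  (p := fun b => mem s aMateB b != 0) _ _)) => //; first by move=> j _; rewrite mE.
move=> s4 t4 fr4 [tE4 tB4]; split; last by move: tB2 tB4 => /=; lia.
rewrite tE4 mE // /s3 /= tE2 /s1 /= fr2.1 //= k0 addn1.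
by rewrite -!cats1 -!catA.
Qed.

Lemma algorithm_ok n (T : rel 'I_n) k l :
  simple T -> semi_complete T -> 5 * k <= l ->
  run algorithm (input T k l) (fun s t => exists o : outcome n,
    [/\ t <= 70 * 100 * (k.+2 * n.+1 ^ 2), output (tape s) o & correct T k l o]).
Proof.
move=> irrT scT lk; set s0 := input T k l.
have P0 : params n k l s0 by [].
apply/run_seq/(run_conseq (prepare_ok P0 _)) => // s1 t1 fr1 [row1 lo1 hi1 tB1].
have P1 := params_frame fr1 isT P0.
(* The adjacency is read off the memory, so that it is defined on all numbers; [RT] identifies it
   with [T] on vertices. *)
pose R u v := mem s1 1 (mem s1 aRow u + v) != 0.
have adj1 u v : u < n -> v < n -> mem s1 1 (u * n + v) = R u v.
  move=> un vn; rewrite /R row1 ?(ltnW un) // fr1.1 //.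
  by rewrite [mem s0 1 _]/=; case: [exists u0, _].
have RT (u v : 'I_n) : R u v = T u v.
  have := adj1 _ _ (ltn_ord u) (ltn_ord v).
  by rewrite fr1.1 // input_adj; case: (R u v); case: (T u v).
pose deg u := size (upto (R u) n).
apply/run_seq/(run_conseq (degrees_ok P1 row1 _ adj1)) => [u|s2 t2 fr2 [deg2 tB2]].
  by rewrite fr1.1.
have P2 := params_frame fr2 isT P1.
have degn u : u < n -> deg u <= n.
  move=> _; rewrite /deg uptoE size_filter -[leqRHS](size_iota 0 n).
  exact: count_size.
apply/run_seq/(run_conseq (sorting_ok P2 _ deg2 degn)).
  by rewrite fr2.1 // fr1.1.
move=> s3 t3 fr3 [ordP degE tB3]; have P3 := params_frame fr3 isT P2.
have deg3 x : x < n -> mem s3 aDeg (mem s3 aOrd x) = deg (mem s3 aOrd x).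
  by move=> xn; rewrite fr3.1 // deg2 //; exact: (ord_lt ordP).
apply/run_seq/(run_conseq (find_degree_tangle_ok (deg := fun x => deg (mem s3 aOrd x)) P3 _ deg3)).
  by rewrite fr3.1 // fr2.1 // fr1.1.
move=> s4 t4 fr4 [tgl tB4]; have P4 := params_frame fr4 isT P3.
have ord4 : mem s4 aOrd = mem s3 aOrd by rewrite fr4.1.
have tape4 : tape s4 = [::] by rewrite fr4.2 // fr3.2 // fr2.2 // fr1.2.
set ord := mem s3 aOrd in ordP degE deg3 tgl ord4.
apply: run_if => /=; case tE : (mem s4 vTangle 0) tgl => [|x] //.
  move=> [xn gap] _.
  apply: (run_conseq (output_degree_tangle_ok P4 tE)) => s5 t5 _ [tape5 tB5].
  have tgl := window_tangle RT ordP xn degE gap.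
  exists (DegreeTangle (seq_set n [seq ord (x + j) | j <- upto xpredT l.+2])).
  split.
  (* A window that fits has [l + 2 <= n], so printing it takes O(n) steps. *)
  - have : l.+3 <= n.+1 by lia.
    by rewrite -mulnn; nia.
  - exists [:: [seq ord (x + j) | j <- upto xpredT l.+2]].
      by rewrite /= (lists_window ordP).
    by rewrite tape5 tape4 ord4 /= cats0 size_map uptoE filter_predT size_iota.
  split=> //; exact: degree_tangle_pathwidth tgl.
move=> gap _; pose adj := position_adj R ord.
have rep4 : represents adj s4.
  move=> a b; rewrite ord4 /adj /position_adj /R.
  by rewrite (fr4.1 1) // (fr4.1 aRow) // (fr3.1 1) // (fr3.1 aRow) // (fr2.1 1) // (fr2.1 aRow).
(* The list names the arrays written by the preprocessing and the tangle test; all others still have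
   their initial contents. *)
have mE a : a \notin [:: 2; 3; 4; 5; 6; 7; 10; 11; 24] -> mem s4 a = mem s0 a.
  rewrite !inE !negb_or => /and5P[a1 a2 a3 a4 /and5P[a5 a6 a7 a8 a9]].
  rewrite fr4.1 ?fr3.1 ?fr2.1 ?fr1.1 //= ?inE ?negb_or ?a1 ?a2 ?a3 ?a4 ?a5 ?a6 ?a7 ?a8 ?a9 //.
have size4 : mem s4 vSize 0 = 0 by rewrite mE.
have st4 : cut_state n l adj 0 l 0 s4.
  split.
    apply: cut_inv0; [| |by rewrite mE|by rewrite mE].
    + by move=> j jn; rewrite fr4.1 // fr3.1 // fr2.1 // lo1.
    by move=> j jn; rewrite fr4.1 // fr3.1 // fr2.1 // hi1.
  rewrite size4 mE // /nmatched (@eq_count _ _ pred0) ?count_pred0 //.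
apply/run_seq/(run_conseq (cuts_ok P4 rep4 st4 size4)).
move=> s5 t5 fr5 [size5 inv tB5]; have P5 := params_frame fr5 isT P4.
have [n5 k5 l5] := P5.
have ord5 : mem s5 aOrd = ord by rewrite fr5.1.
have tape5 : tape s5 = [::] by rewrite fr5.2.
apply: run_if => /=; rewrite k5 => sk.
  case: inv => [[]|[sk5 [i iln mat]]]; first by lia.
  apply/run_seq/run_emit; set s6 := State _ _.
  apply: (run_conseq (output_sides_ok (s := s6) P5)) => s7 t7 _ [tape7 tB7].
  have num : nmatched n (mem s5 aMateA) = k.+1 by rewrite -size5.
  have gap' : size (upto (R (ord i)) n) + k < size (upto (R (ord (i + l + 1))) n).
    have -> : i + l + 1 = i + l.+1 by lia.
    by apply: gap; lia.
  have tgl := matching_tangle_of RT ordP iln degE gap' mat num.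
  have listX := lists_ord_upto ordP (fun a => mem s5 aMateA a != 0).
  have listY := lists_ord_upto ordP (fun b => mem s5 aMateB b != 0).
  have [_ cX cY _ _] := tgl.
  exists (MatchingTangle (seq_set n (map ord (upto (fun a => mem s5 aMateA a != 0) n)))
                         (seq_set n (map ord (upto (fun b => mem s5 aMateB b != 0) n)))).
  split.
  - have le2 : n.+1 <= n.+1 ^ 2 by rewrite -mulnn leq_pmulr.
    have leX : n.+1 ^ 2 <= k.+2 * n.+1 ^ 2 by rewrite leq_pmull.
    move: tB1 tB2 tB3 tB4 tB5 tB7 le2 leX => /=.
    by set x := n.+1 ^ 2; set y := k.+2 * x; lia.
  - exists [:: map ord (upto (fun a => mem s5 aMateA a != 0) n);
               map ord (upto (fun b => mem s5 aMateB b != 0) n)].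
      by rewrite /= listX listY.
    rewrite tape7 /s6 /= tape5 ord5 cats0.
    by rewrite (lists_card listX) (lists_card listY) cX cY.
  by split=> //; exact: matching_tangle_pathwidth tgl.
case: inv => [[_ [lab ear lat]]|[]]; last by lia.
apply: (run_conseq (output_bags_ok P5)) => s6 t6 _ [tape6 tB6].
exists (PathDecomposition [seq seq_set n (bag_list n ord (mem s5 aLo) (mem s5 aHi) i)
  | i <- iota 0 (n - l.+1).+1]).
split.
- have le2 : n.+1 <= n.+1 ^ 2 by rewrite -mulnn leq_pmulr.
  have leX : n.+1 ^ 2 <= k.+2 * n.+1 ^ 2 by rewrite leq_pmull.
  move: tB1 tB2 tB3 tB4 tB5 tB6 le2 leX => /=.
  by set x := n.+1 ^ 2; set y := k.+2 * x; lia.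
- exists (map (bag_list n ord (mem s5 aLo) (mem s5 aHi)) (iota 0 (n - l.+1).+1)).
    exact: (lists_bags ordP).
  by rewrite tape6 tape5 ord5.
split; first exact: (bags_path_decomposition RT ordP lab).
exact: (bags_width ordP ear lat).
Qed.

Theorem theorem32 :
  exists (p : cmd) (C : nat),
  forall (n : nat) (T : rel 'I_n) (k l : nat),
    simple T -> semi_complete T -> 5 * k <= l ->
    exists (s : state) (t : nat) (o : outcome n),
      [/\ exec p (input T k l) s t,
          t <= C * (maxn 1 k * maxn 1 n ^ 2),
          output (tape s) o
        & correct T k l o].
Proof.
(* A product, since a literal above 5000 would be opaque to lia. *)
exists algorithm, (840 * 100) => n T k l irrT scT lk.
have [s [t [ex [o [tB out cor]]]]] := algorithm_ok irrT scT lk.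
by exists s, t, o; split=> //; exact: budget.
Qed.
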